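(* Let $f$ be an octonion-valued slice regular function on $\mathbb B=\{w\in\mathbb O:|w|<1\}$ such that, for some $I\in\mathbb S$, its restriction $f_I$ to $\mathbb B_I$ is injective and $f(\mathbb B_I)\subseteq\mathbb C_I$. If $f(0)=0$ and $f'(0)=1$, then $$B\big(0,\tfrac14\big)\subset f(\mathbb B).$$
   Context: $\mathbb O$ is the real division algebra of octonions, with norm $|w|$; $B(0,R)=\{w\in\mathbb O:|w|<R\}$. $\mathbb S=\{w\in\mathbb O:w^2=-1\}$; for $I\in\mathbb S$, $\mathbb C_I=\mathbb R\oplus I\mathbb R$ and $\Omega_I=\Omega\cap\mathbb C_I$. $f:\Omega\to\mathbb O$ on a domain $\Omega\subseteq\mathbb O$ is slice regular if for every $I\in\mathbb S$ its restriction $f_I$ to $\Omega_I$ has continuous partial derivatives and $\frac12(\frac{\partial}{\partial x}+I\frac{\partial}{\partial y})f_I(x+yI)=0$ on $\Omega_I$. The slice derivative is $f'(x+yI)=\frac12(\frac{\partial}{\partial x}-I\frac{\partial}{\partial y})f_I(x+yI)$. *)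

(* Defs.v *)
From Stdlib Require Import Reals.
From Coquelicot Require Export Coquelicot.
Open Scope R_scope.

(* The octonions by the Cayley-Dickson construction, starting from
   Coquelicot's complex numbers: (a, b) (c, d) = (a c - d^* b, d a + b c^* ). *)

Definition quat : Type := (C * C)%type.

Canonical quat_NormedModule : NormedModule R_AbsRing :=
  NormedModule.Pack R_AbsRing quat
    (NormedModule.class R_AbsRing
      (prod_NormedModule R_AbsRing C_R_NormedModule C_R_NormedModule)) quat.

Definition quat_conj (p : quat) : quat := (Cconj (fst p), Copp (snd p)).

Definition quat_mult (p q : quat) : quat :=
  (Cminus (Cmult (fst p) (fst q)) (Cmult (Cconj (snd q)) (snd p)),
   Cplus (Cmult (snd q) (fst p)) (Cmult (snd p) (Cconj (fst q)))).

Definition oct : Type := (quat * quat)%type.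

(* [norm] is the square root of the sum of the squares of the eight real
   coordinates: the norm that Coquelicot puts on a product of normed modules
   is the Euclidean one. *)
Canonical oct_NormedModule : NormedModule R_AbsRing :=
  NormedModule.Pack R_AbsRing oct
    (NormedModule.class R_AbsRing
      (prod_NormedModule R_AbsRing quat_NormedModule quat_NormedModule)) oct.

Definition oct_norm (w : oct) : R := @norm R_AbsRing oct_NormedModule w.

Definition oct_plus (v w : oct) : oct := @plus oct_NormedModule v w.

Definition oct_opp (w : oct) : oct := @opp oct_NormedModule w.

Definition oct_scal (r : R) (w : oct) : oct :=
  @scal R_AbsRing oct_NormedModule r w.

Definition oct_mult (v w : oct) : oct :=
  (@minus quat_NormedModule
     (quat_mult (fst v) (fst w)) (quat_mult (quat_conj (snd w)) (snd v)),
   @plus quat_NormedModule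
     (quat_mult (snd w) (fst v)) (quat_mult (snd v) (quat_conj (fst w)))).

Definition oct_zero : oct := @zero oct_NormedModule.

Definition oct_one : oct := ((RtoC 1, RtoC 0), (RtoC 0, RtoC 0)).

Definition oct_ball (r : R) (w : oct) : Prop := oct_norm w < r.

Definition imag_unit (I : oct) : Prop := oct_mult I I = oct_opp oct_one.

(* x + y I *)
Definition slice_point (I : oct) (x y : R) : oct :=
  oct_plus (oct_scal x oct_one) (oct_scal y I).

Definition in_slice (I w : oct) : Prop :=
  exists x y : R, w = slice_point I x y.

Definition is_partial_x (f : oct -> oct) (I : oct) (x y : R) (d : oct) : Prop :=
  @is_derive R_AbsRing oct_NormedModule (fun t : R => f (slice_point I t y)) x d.

Definition is_partial_y (f : oct -> oct) (I : oct) (x y : R) (d : oct) : Prop :=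
  @is_derive R_AbsRing oct_NormedModule (fun t : R => f (slice_point I x t)) y d.

(* Om is meant to be open, so the values of f, fx and fy outside Om do not
   matter. *)
Definition slice_regular (Om : oct -> Prop) (f : oct -> oct) : Prop :=
  forall I : oct, imag_unit I ->
  exists fx fy : R -> R -> oct,
  forall x y : R, Om (slice_point I x y) ->
    is_partial_x f I x y (fx x y) /\
    is_partial_y f I x y (fy x y) /\
    @continuous (prod_UniformSpace R_UniformSpace R_UniformSpace)
      oct_NormedModule (fun p : R * R => fx (fst p) (snd p)) (x, y) /\
    @continuous (prod_UniformSpace R_UniformSpace R_UniformSpace)
      oct_NormedModule (fun p : R * R => fy (fst p) (snd p)) (x, y) /\
    oct_scal (1 / 2) (oct_plus (fx x y) (oct_mult I (fy x y))) = oct_zero.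

(* f'(w) = d.  A point w has several representations x + y I (for real w, any
   I will do); the formula is required for all of them.  For slice regular f
   they all give the same value. *)
Definition is_slice_derivative (f : oct -> oct) (w d : oct) : Prop :=
  forall (I : oct) (x y : R), imag_unit I -> w = slice_point I x y ->
  exists dx dy : oct,
    is_partial_x f I x y dx /\
    is_partial_y f I x y dy /\
    d = oct_scal (1 / 2) (oct_plus dx (oct_opp (oct_mult I dy))).

(* Main.v *)
(* On the slice of [I] the function [f] is a univalent holomorphic [g] with [g 0 = 0], [g' 0 = 1].

   Koebe bound [|z| <= 4 |g z|], by transfinite diameter.  Put [phi = 1 / g] and fix [|z0| = rho],
   [p = phi z0], [L = |p|].  As [g] has mean 0, some value of [phi] on [|z| = rho] is at distance at
   least [L] from [p], so [w |-> |w - p|], which is 1-Lipschitz, maps the curve [phi (|z| = rho)] onto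
   a set containing [[0, L]]; choose points [w_j = phi zeta_j] over Chebyshev nodes [x_j] of [[0, L]].
   By univalence the product of the [1 / (z (phi z - w_j))] is holomorphic in [|z| < rho] with
   value 1 at 0, so for [rho' < rho] some [|z| = rho'] satisfies [prod |phi z - w_j| <= rho'^-n].
   Up to a factor [(1 + o(1))^n] the left-hand side is at least [(L / 4)^n], because
   [|phi z - w_j| >= |t - x_j|] for some [t] in [[0, L]].  Hence [L rho <= 4].

   Solving [f z = w].  Split [w = a + w2] with [a] in the slice and [w2] orthogonal to it,
   [b = |w2|^2].  With [g^ z = conj (g (conj z))], the function [(g - a) (g^ - conj a) + b] has a zero
   [x + y i]: otherwise a quotient of holomorphic functions has positive real part on a circle
   [|z| = r], where [|g|, |g^| > |w|] by the Koebe bound, and value [-1] at the centre.  By the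
   representation formula [f (x + y J) = alpha + J beta], where [alpha], [beta] in the slice depend
   only on [x], [y]; the vanishing says [|w - alpha| = |beta|] and [<w - alpha, beta> = 0], so that
   [J = (w - alpha) beta^-1] is an imaginary unit with [f (x + y J) = w].

   Everything analytic rests on one fact: a holomorphic function whose real part is positive on a
   circle has positive real part at the centre. *)

Require Import Defs.
From Stdlib Require Import Reals Lra Lia List ClassicalEpsilon IndefiniteDescription ssreflect.
From Coquelicot Require Import Coquelicot.
Open Scope R_scope.

(** * Holomorphic functions *)

Definition cderiv (f : R -> C) (x : R) (d : C) : Prop :=
  is_derive (fun s => Re (f s)) x (Re d) /\ is_derive (fun s => Im (f s)) x (Im d).

Definition ccont (h : C -> C) (z : C) : Prop :=
  continuous (fun w : C => Re (h w)) z /\ continuous (fun w : C => Im (h w)) z.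

(** Partial derivatives [d] and [i d] encode the Cauchy-Riemann equations in the form closest to
    slice regularity. *)
Definition has_cderiv (h : C -> C) (z d : C) : Prop :=
  cderiv (fun s => h (s, Im z)) (Re z) d /\
  cderiv (fun s => h (Re z, s)) (Im z) (Ci * d)%C.

(** Holomorphy in the C^1 sense: continuity of [h'] is what permits differentiation under the
    integral sign on circles. *)
Definition hol (Om : C -> Prop) (h : C -> C) : Prop :=
  exists h' : C -> C, forall z, Om z ->
    ccont h z /\ has_cderiv h z (h' z) /\ ccont h' z.

Definition circ (z0 : C) (t a : R) : C := (Re z0 + t * cos a, Im z0 + t * sin a).

Ltac cfold := repeat (progress (unfold Re, Im, Cplus, Cmult, Copp, Cminus, Ci, RtoC, Cconj, circ; simpl)).

(* Coquelicot states many real equalities in the carrier of [R_NormedModule], which [ring] and [field]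
   do not recognize. *)
Ltac toR := match goal with |- @eq _ ?a ?b => change (@eq R a b) end.
Ltac toC := match goal with |- @eq _ ?a ?b => change (@eq C a b) end.

Lemma is_derive_eq (f : R -> R) x (l l' : R) : is_derive f x l -> l = l' -> is_derive f x l'.
Proof. now intros H <-. Qed.

Lemma cderiv_eq (f : R -> C) x l l' : cderiv f x l -> l = l' -> cderiv f x l'.
Proof. now intros H <-. Qed.

Lemma is_derive_Rmult (f g : R -> R) x (df dg : R) : is_derive f x df -> is_derive g x dg ->
  is_derive (fun s => f s * g s) x (df * g x + f x * dg).
Proof. move=> a b. apply: is_derive_mult => // n m. exact: Rmult_comm. Qed.

Lemma is_derive_Rplus (f g : R -> R) x (df dg : R) : is_derive f x df -> is_derive g x dg ->
  is_derive (fun s => f s + g s) x (df + dg).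
Proof. exact: is_derive_plus. Qed.

Lemma is_derive_Rminus (f g : R -> R) x (df dg : R) : is_derive f x df -> is_derive g x dg ->
  is_derive (fun s => f s - g s) x (df - dg).
Proof. exact: is_derive_minus. Qed.

Lemma is_derive_Ropp (f : R -> R) x (df : R) : is_derive f x df ->
  is_derive (fun s => - f s) x (- df).
Proof. exact: is_derive_opp. Qed.

Lemma is_derive_Rdiv (f g : R -> R) x (df dg : R) : g x <> 0 -> is_derive f x df -> is_derive g x dg ->
  is_derive (fun s => f s / g s) x ((df * g x - f x * dg) / (g x) ^ 2).
Proof.
move=> gx a b.
apply: (is_derive_eq _ _ (df * (/ g x) + f x * (- dg / g x ^ 2))); last by field.
apply: is_derive_Rmult => //. exact: is_derive_inv.
Qed.

Lemma cderiv_const (c : C) x : cderiv (fun _ => c) x 0.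
Proof. split; apply: is_derive_const. Qed.

Lemma cderiv_plus f g x df dg : cderiv f x df -> cderiv g x dg ->
  cderiv (fun s => f s + g s)%C x (df + dg)%C.
Proof. intros [a b] [c d]; split; apply: is_derive_Rplus; assumption. Qed.

Lemma cderiv_mult f g x df dg : cderiv f x df -> cderiv g x dg ->
  cderiv (fun s => f s * g s)%C x (df * g x + f x * dg)%C.
Proof.
intros [a b] [c d]; split; cfold.
  eapply is_derive_eq; [apply: is_derive_Rminus; apply: is_derive_Rmult; eassumption|toR; unfold Re, Im; simpl; ring].
eapply is_derive_eq; [apply: is_derive_Rplus; apply: is_derive_Rmult; eassumption|toR; unfold Re, Im; simpl; ring].
Qed.

Lemma sumsq_neq0 (z : C) : z <> 0%C -> fst z ^ 2 + snd z ^ 2 <> 0.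
Proof.
destruct z as [x y]; simpl => H E. apply: H.
have ->: x = 0 by nra. have ->: y = 0 by nra. by [].
Qed.

Lemma cderiv_inv (f : R -> C) x (df : C) : f x <> 0%C -> cderiv f x df ->
  cderiv (fun s => / f s)%C x (- df / (f x * f x))%C.
Proof.
move=> f0 [a b]. have fx := sumsq_neq0 _ f0.
have sq : is_derive (fun s => fst (f s) ^ 2 + snd (f s) ^ 2) x (2 * fst (f x) * fst df + 2 * snd (f x) * snd df).
  apply: (is_derive_ext (fun s => fst (f s) * fst (f s) + snd (f s) * snd (f s))); first by move=> t; toR; ring.
  eapply is_derive_eq; [apply: is_derive_Rplus; apply: is_derive_Rmult; eassumption|toR; unfold Re, Im; simpl; rewrite /Re /Im; ring].
have E: (- df / (f x * f x) = - df * (/ f x * / f x))%C by field.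
rewrite E.
split; rewrite /Cinv; cfold.
  eapply is_derive_eq; [apply: is_derive_Rdiv; eassumption|].
  toR; unfold Re, Im; simpl; field; move=> H; apply: fx; simpl; lra.
eapply is_derive_eq; [apply: is_derive_Rdiv; try eassumption; apply: is_derive_Ropp; eassumption|].
toR; unfold Re, Im; simpl; field; move=> H; apply: fx; simpl; lra.
Qed.

Lemma ccont_continuous h z : ccont h z <-> continuous h z.
Proof.
split.
  move=> [a b] P [e He].
  have [da Ha] := a _ (locally_ball (Re (h z)) e).
  have [db Hb] := b _ (locally_ball (Im (h z)) e).
  have mp : 0 < Rmin da db by apply: Rmin_glb_lt; apply: cond_pos.
  exists (mkposreal _ mp) => y By. apply: He; split.
    apply: Ha. apply: ball_le By. exact: Rmin_l.
  apply: Hb. apply: ball_le By. exact: Rmin_r.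
move=> H; split.
  apply: (continuous_comp h (fun z : C => fst z)) => //; destruct (h z); apply: continuous_fst.
apply: (continuous_comp h (fun z : C => snd z)) => //; destruct (h z); apply: continuous_snd.
Qed.

Lemma ccont_const (c z : C) : ccont (fun _ => c) z.
Proof. split; apply: continuous_const. Qed.

Lemma ccont_plus f g z : ccont f z -> ccont g z -> ccont (fun w => f w + g w)%C z.
Proof. move=> [a b] [c d]; split; exact: continuous_plus. Qed.

Lemma ccont_mult f g z : ccont f z -> ccont g z -> ccont (fun w => f w * g w)%C z.
Proof.
move=> [a b] [c d]; split.
  apply: continuous_minus; exact: continuous_mult.
apply: continuous_plus; exact: continuous_mult.
Qed.

Lemma ccont_inv (f : C -> C) z : f z <> 0%C -> ccont f z -> ccont (fun w => / f w)%C z.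
Proof.
move=> f0 [a b]. have fz := sumsq_neq0 _ f0.
have sq : continuous (fun w => / (fst (f w) ^ 2 + snd (f w) ^ 2)) z.
  apply: (continuous_comp (fun w => fst (f w) ^ 2 + snd (f w) ^ 2) Rinv).
    apply: (continuous_ext (fun s => fst (f s) * fst (f s) + snd (f s) * snd (f s))); first by move=> t; toR; unfold Re, Im; simpl; ring.
    apply: continuous_plus; exact: continuous_mult.
  exact: continuous_Rinv.
split.
  exact: continuous_mult.
apply: continuous_mult => //. exact: continuous_opp.
Qed.

Lemma ccont_comp f g z : ccont f z -> ccont g (f z) -> ccont (fun w => g (f w)) z.
Proof. move=> /ccont_continuous a /ccont_continuous b; apply/ccont_continuous; exact: continuous_comp. Qed.

Lemma ccont_id z : ccont (fun w => w) z.
Proof. apply/ccont_continuous. exact: continuous_id. Qed.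

Lemma hol_const Om c : hol Om (fun _ => c).
Proof.
exists (fun _ => 0%C) => z _; split; [exact: ccont_const|split; [|exact: ccont_const]].
split; apply: (cderiv_eq _ _ 0%C); try exact: cderiv_const; toC; ring.
Qed.

Lemma hol_id Om : hol Om (fun z => z).
Proof.
exists (fun _ => 1%C) => z _; split; [exact: ccont_id|split; [|exact: ccont_const]].
split; split; cfold.
- apply: is_derive_id.
- apply: is_derive_const.
- apply: is_derive_eq; [apply: is_derive_const|]. toR; unfold Re, Im; simpl; rewrite /zero /=; ring.
- apply: is_derive_eq; [apply: is_derive_id|]. toR; unfold Re, Im; simpl; rewrite /one /=; ring.
Qed.

Lemma hol_plus Om f g : hol Om f -> hol Om g -> hol Om (fun z => f z + g z)%C.
Proof.
move=> [f' Hf] [g' Hg]; exists (fun z => f' z + g' z)%C => z Oz.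
move: (Hf z Oz) (Hg z Oz) => [a [[b1 b2] c]] [a' [[b1' b2'] c']].
split; [exact: ccont_plus|split; [|exact: ccont_plus]].
split; first exact: cderiv_plus.
apply: cderiv_eq; [apply: cderiv_plus; eassumption|]. ring.
Qed.

Lemma hol_mult Om f g : hol Om f -> hol Om g -> hol Om (fun z => f z * g z)%C.
Proof.
move=> [f' Hf] [g' Hg]; exists (fun z => f' z * g z + f z * g' z)%C => z Oz.
move: (Hf z Oz) (Hg z Oz) => [a [[b1 b2] c]] [a' [[b1' b2'] c']].
split; [exact: ccont_mult|split; [|by apply: ccont_plus; apply: ccont_mult]].
have E : z = (Re z, Im z) by destruct z.
split; apply: cderiv_eq; try (apply: cderiv_mult; eassumption); rewrite /= -E; ring.
Qed.

Lemma hol_inv Om (f : C -> C) : (forall z, Om z -> f z <> 0%C) -> hol Om f -> hol Om (fun z => / f z)%C.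
Proof.
move=> nz [f' Hf]; exists (fun z => - f' z / (f z * f z))%C => z Oz.
move: (Hf z Oz) (nz z Oz) => [a [[b1 b2] c]] fz.
have E : z = (Re z, Im z) by destruct z.
split; [exact: ccont_inv|split].
  split; apply: cderiv_eq; try (apply: cderiv_inv; try eassumption; by rewrite /= -E); rewrite /= -E; by field.
apply: ccont_mult.
  apply: ccont_comp c _. apply/ccont_continuous. apply: (continuous_opp (V:=C_R_NormedModule)). exact: continuous_id.
apply: ccont_inv; last exact: ccont_mult. exact: Cmult_neq_0.
Qed.

Lemma hol_subset (Om Om' : C -> Prop) f : (forall z, Om' z -> Om z) -> hol Om f -> hol Om' f.
Proof. move=> s [f' H]; exists f' => z /s; exact: H. Qed.

Lemma hol_ext Om f g : (forall z, f z = g z) -> hol Om f -> hol Om g.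
Proof. by move=> /FunctionalExtensionality.functional_extensionality ->. Qed.

Lemma hol_minus Om f g : hol Om f -> hol Om g -> hol Om (fun z => f z - g z)%C.
Proof.
move=> Hf Hg. apply: (hol_ext _ (fun z => f z + (-1) * g z)%C); first by move=> z; toC; ring.
apply: hol_plus => //. apply: hol_mult => //. exact: hol_const.
Qed.

Lemma hol_div Om f (g : C -> C) : (forall z, Om z -> g z <> 0%C) ->
  hol Om f -> hol Om g -> hol Om (fun z => f z / g z)%C.
Proof. move=> nz Hf Hg. apply: hol_mult => //. exact: hol_inv. Qed.

Lemma hol_ccont Om h z : hol Om h -> Om z -> ccont h z.
Proof. by move=> [h' H] /H []. Qed.

Lemma Cmod_circ z0 t a : Cmod (circ z0 t a - z0) = Rabs t.
Proof.
rewrite /Cmod -sqrt_Rsqr_abs. f_equal. rewrite /Rsqr. cfold.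
have := sin2_cos2 a; rewrite /Rsqr => H.
transitivity (t * t * (sin a * sin a + cos a * cos a)); first by ring. rewrite H; ring.
Qed.

Lemma sqrt2_lt_2 : sqrt 2 < 2.
Proof.
rewrite -[X in _ < X](sqrt_Rsqr 2); last lra. apply: sqrt_lt_1_alt; rewrite /Rsqr; lra.
Qed.

Lemma locally_Cmod_lt (z0 z : C) R : Cmod (z - z0) < R -> locally z (fun w : C => Cmod (w - z0) < R).
Proof.
move=> H.
have e0 : 0 < (R - Cmod (z - z0)) / 2 by lra.
exists (mkposreal _ e0) => w Bw.
have := C_NormedModule_mixin_compat2 z w _ Bw. rewrite /minus /plus /opp /=.
have -> : (w - z0 = (w + - z) + (z - z0))%C by ring.
have := Cmod_triangle (w + - z)%C (z - z0)%C.
have := sqrt2_lt_2.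
nra.
Qed.

Lemma locally_Cmod_gt (z0 z : C) r : r < Cmod (z - z0) -> locally z (fun w : C => r < Cmod (w - z0)).
Proof.
move=> H.
have e0 : 0 < (Cmod (z - z0) - r) / 2 by lra.
exists (mkposreal _ e0) => w Bw.
have := C_NormedModule_mixin_compat2 z w _ Bw. rewrite /minus /plus /opp /=.
have := Cmod_triangle (- (w + - z))%C (w - z0)%C.
have -> : (- (w + - z) + (w - z0) = z - z0)%C by ring.
rewrite Cmod_opp.
have := sqrt2_lt_2.
nra.
Qed.

Lemma C_eta (z : C) : (Re z, Im z) = z.
Proof. by destruct z. Qed.

(** Real differentiability whose Jacobian matrix is that of multiplication by [d]. *)
Definition cdiff (h : C -> C) (z d : C) : Prop :=
  differentiable_pt_lim (fun x y => Re (h (x, y))) (Re z) (Im z) (Re d) (- Im d) /\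
  differentiable_pt_lim (fun x y => Im (h (x, y))) (Re z) (Im z) (Im d) (Re d).

(** The x-partial exists nearby and is continuous at [z], and the y-partial exists at [z]; this
    yields the total differential that the chain rule in polar coordinates requires. *)
Lemma has_cderiv_cdiff (h h' : C -> C) z :
  locally z (fun w => has_cderiv h w (h' w)) -> ccont h' z -> cdiff h z (h' z).
Proof.
move=> L [c1 c2].
have [[a1 a2] [b1 b2]] := locally_singleton _ _ L.
have {}c1 : continuous (fun u : R * R => Re (h' (fst u, snd u))) (Re z, Im z).
  rewrite C_eta. apply: continuous_ext c1 => -[] //.
have {}c2 : continuous (fun u : R * R => Im (h' (fst u, snd u))) (Re z, Im z).
  rewrite C_eta. apply: continuous_ext c2 => -[] //.
rewrite -{1}(C_eta z) in L.
split; apply/filterdiff_differentiable_pt_lim.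
- have H := is_derive_filterdiff (fun x y => Re (h (x, y))) (Re z) (Im z) (fun x y => Re (h' (x, y))) (Re (Ci * h' z)%C) _ b1 c1.
  apply: filterdiff_ext_lin; first (apply: H).
    apply: filter_imp L => -[x y] [[? _] _] //.
  move=> [y1 y2]; rewrite /plus /scal /= /mult /= C_eta. cfold. ring.
- have H := is_derive_filterdiff (fun x y => Im (h (x, y))) (Re z) (Im z) (fun x y => Im (h' (x, y))) (Im (Ci * h' z)%C) _ b2 c2.
  apply: filterdiff_ext_lin; first (apply: H).
    apply: filter_imp L => -[x y] [[_ ?] _] //.
  move=> [y1 y2]; rewrite /plus /scal /= /mult /= C_eta. cfold. ring.
Qed.

(** * Polar coordinates and means over circles *)

Lemma is_derive_circ_t z0 t a : is_derive (fun s => Re (circ z0 s a)) t (cos a) /\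
  is_derive (fun s => Im (circ z0 s a)) t (sin a).
Proof. split; rewrite /=; auto_derive => //; ring. Qed.

Lemma is_derive_circ_a z0 t a : is_derive (fun s => Re (circ z0 t s)) a (- t * sin a) /\
  is_derive (fun s => Im (circ z0 t s)) a (t * cos a).
Proof. split; rewrite /=; auto_derive => //; ring. Qed.

Lemma continuous_circ z0 t a : continuous (fun p : R * R => circ z0 (fst p) (snd p)) (t, a).
Proof.
have ct : continuous (fun p : R * R => fst p) (t, a) by apply: continuous_fst.
have ca : continuous (fun p : R * R => snd p) (t, a) by apply: continuous_snd.
apply/(ccont_continuous (fun p : C => circ z0 (fst p) (snd p))). split; rewrite /=.
  apply: continuous_plus; first exact: continuous_const.
  apply: continuous_mult => //. apply: continuous_comp ca _. exact: continuous_cos.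
apply: continuous_plus; first exact: continuous_const.
apply: continuous_mult => //. apply: continuous_comp ca _. exact: continuous_sin.
Qed.

Lemma continuity_2d_circ (k : C -> C) z0 t a : ccont k (circ z0 t a) ->
  continuity_2d_pt (fun t a => Re (k (circ z0 t a))) t a /\
  continuity_2d_pt (fun t a => Im (k (circ z0 t a))) t a.
Proof.
move=> [c1 c2].
split; apply/continuity_2d_pt_filterlim.
  apply: (continuous_comp (fun p : R * R => circ z0 (fst p) (snd p)) (fun w => Re (k w)) (t, a)) => //.
  exact: continuous_circ.
apply: (continuous_comp (fun p : R * R => circ z0 (fst p) (snd p)) (fun w => Im (k w)) (t, a)) => //.
exact: continuous_circ.
Qed.

Lemma continuity_2d_pt_r f x y : continuity_2d_pt f x y -> continuous (fun t => f x t) y.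
Proof.
move=> H P [e He]. have [d Hd] := H e. exists d => z Bz. apply: He. apply: Hd => //.
by rewrite Rminus_diag Rabs_R0; apply: cond_pos.
Qed.

Lemma circ_2PI z0 t : circ z0 t (2 * PI) = circ z0 t 0.
Proof. by rewrite /circ cos_2PI sin_2PI cos_0 sin_0. Qed.

(** The mean of [Re h] over [|z - z0| = t] does not depend on [t]; if it were positive at [t = rho],
    letting [t] tend to 0 would contradict [Re (h z0) <= 0]. At the centre only continuity is
    assumed, so that quotients like [g z / z] are covered. *)
Lemma circle_principle (h : C -> C) (z0 : C) (r rho : R) :
  hol (fun z => 0 < Cmod (z - z0) < r) h -> ccont h z0 -> 0 < rho < r ->
  Re (h z0) <= 0 -> exists a, 0 <= a <= 2 * PI /\ Re (h (circ z0 rho a)) <= 0.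
Proof.
move=> [h' Hh] h0 [rho0 rhor] hz0. apply: NNPP => noa.
have pos a : 0 <= a <= 2 * PI -> 0 < Re (h (circ z0 rho a)).
  move=> ar.
  case: (Rle_lt_dec (Re (h (circ z0 rho a))) 0) => // le. by case: noa; exists a.
have cU t a : Rabs t < r -> continuity_2d_pt (fun t a => Re (h (circ z0 t a))) t a.
  move=> tr. suff c : ccont h (circ z0 t a) by apply (continuity_2d_circ _ _ _ _ c).
  case: (Req_dec t 0) => [->|t0].
    have -> : circ z0 0 a = z0 by rewrite /circ !Rmult_0_l !Rplus_0_r C_eta.
    done.
  apply: (proj1 (Hh _ _)). rewrite Cmod_circ. split => //. exact: Rabs_pos_lt.
(* Cauchy-Riemann in polar coordinates: [t] times the radial derivative of [Re h] is the angular
   derivative of [Im h]. *)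
have D t a : 0 < t < r ->
   is_derive (fun s => Re (h (circ z0 s a))) t (Re (h' (circ z0 t a) * (cos a, sin a))%C) /\
   is_derive (fun s => Im (h (circ z0 t s))) a (t * Re (h' (circ z0 t a) * (cos a, sin a))%C).
  move=> tr.
  have zr : 0 < Cmod (circ z0 t a - z0) < r by rewrite Cmod_circ Rabs_pos_eq; lra.
  have [] := has_cderiv_cdiff h h' (circ z0 t a) _ (proj2 (proj2 (Hh _ zr))).
    apply: filter_imp (filter_and _ _ (locally_Cmod_lt _ _ _ (proj2 zr)) (locally_Cmod_gt _ _ _ (proj1 zr))) => w [w1 w2].
    by apply (Hh w).
  move=> d1 d2; split; apply/is_derive_Reals.
    have [e1 e2] := is_derive_circ_t z0 t a.
    have := derivable_pt_lim_comp_2d _ (fun s => Re (circ z0 s a)) (fun s => Im (circ z0 s a)) t _ _ _ _ d1 (proj1 (is_derive_Reals _ _ _) e1) (proj1 (is_derive_Reals _ _ _) e2).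
    by congr derivable_pt_lim; cfold; ring.
  have [e1 e2] := is_derive_circ_a z0 t a.
  have := derivable_pt_lim_comp_2d _ (fun s => Re (circ z0 t s)) (fun s => Im (circ z0 t s)) a _ _ _ _ d2 (proj1 (is_derive_Reals _ _ _) e1) (proj1 (is_derive_Reals _ _ _) e2).
  by congr derivable_pt_lim; cfold; ring.
have cD t a : 0 < t < r -> continuity_2d_pt (fun t a => Re (h' (circ z0 t a) * (cos a, sin a))%C) t a.
  move=> tr.
  have zr : 0 < Cmod (circ z0 t a - z0) < r by rewrite Cmod_circ Rabs_pos_eq; lra.
  have [c1 c2] := continuity_2d_circ _ _ _ _ (proj2 (proj2 (Hh _ zr))).
  apply: continuity_2d_pt_minus; apply: continuity_2d_pt_mult => //;
   (apply: continuity_1d_2d_pt_comp; last exact: continuity_2d_pt_id2).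
    exact: continuity_cos.
  exact: continuity_sin.
have twoPI := PI_RGT_0.
pose I t := RInt (fun a => Re (h (circ z0 t a))) 0 (2 * PI).
have exI t : Rabs t < r -> ex_RInt (fun a => Re (h (circ z0 t a))) 0 (2 * PI).
  move=> tr. apply: ex_RInt_continuous => a _. apply: (continuity_2d_pt_r (fun t a => Re (h (circ z0 t a)))). exact: cU.
have loc t : 0 < t < r -> locally t (fun s => 0 < s < r).
  move=> tr. apply: filter_and; [apply: (open_gt 0)|apply: (open_lt r)]; lra.
(* The integrand is [1 / t] times an angular derivative, whose integral over a full turn
   vanishes. *)
have I' t : 0 < t < r -> is_derive I t 0.
  move=> tr.
  have H : is_derive I t (RInt (fun a => Derive (fun u => Re (h (circ z0 u a))) t) 0 (2 * PI)).
    apply: (is_derive_RInt_param (fun t a => Re (h (circ z0 t a)))).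
    - apply: filter_imp (loc _ tr) => s sr a _. eexists; exact: (proj1 (D _ a sr)).
    - move=> a _. apply: continuity_2d_pt_ext_loc (cD t a tr).
      have [d Hd] := loc _ tr.
      exists d => u v ut _. symmetry. apply: is_derive_unique. apply D. exact: Hd.
    - apply: filter_imp (loc _ tr) => s sr. apply: exI. rewrite Rabs_pos_eq; lra.
  have E : RInt (fun a => Derive (fun u => Re (h (circ z0 u a))) t) 0 (2 * PI) = 0.
    have K : is_RInt (fun a => t * Re (h' (circ z0 t a) * (cos a, sin a))%C) 0 (2 * PI)
        (minus (Im (h (circ z0 t (2 * PI)))) (Im (h (circ z0 t 0)))).
      apply: (is_RInt_derive (fun s => Im (h (circ z0 t s)))) => a _; first by apply D.
      apply: (continuous_scal_r (K := R_AbsRing)). apply: (continuity_2d_pt_r (fun t a => Re (h' (circ z0 t a) * (cos a, sin a))%C)). exact: cD.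
    have {}K := is_RInt_scal _ _ _ (/ t) _ K.
    rewrite circ_2PI minus_eq_zero scal_zero_r in K.
    apply: is_RInt_unique. apply: is_RInt_ext K => a _.
    rewrite (is_derive_unique _ _ _ (proj1 (D t a tr))) /scal /= /mult /=. field. lra.
  by rewrite E in H.
have Ic t : 0 < t < rho -> I t = I rho.
  move=> tr. apply: eq_is_derive; last by lra. move=> s sr. apply: I'. lra.
have Ipos : 0 < I rho.
  apply: RInt_gt_0; [lra|move=> *; apply: pos; lra|].
  move=> a _. apply: (continuity_2d_pt_r (fun t a => Re (h (circ z0 t a)))). apply: cU. rewrite Rabs_pos_eq; lra.
(* Integrated over length [2 PI], this tolerance gives at most [I rho / 2] on small circles, less
   than the constant value [I rho]. *)
have e0 : 0 < I rho / (4 * PI) by apply: Rdiv_lt_0_compat; lra.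
have [d Hd] := uniform_continuity_2d (fun t a => Re (h (circ z0 t a))) 0 rho 0 (2 * PI)
  (fun x y xr _ => cU x y ltac:(rewrite Rabs_pos_eq; lra)) (mkposreal _ e0).
have dp := cond_pos d.
pose t := Rmin (d / 2) (rho / 2).
have t0 : 0 < t by apply: Rmin_glb_lt; lra.
have t1 : t <= d / 2 by exact: Rmin_l.
have t2 : t <= rho / 2 by exact: Rmin_r.
have : I t <= RInt (fun _ => I rho / (4 * PI)) 0 (2 * PI).
  apply: RInt_le; [lra|apply: exI; rewrite Rabs_pos_eq; lra|exact: ex_RInt_const|].
  move=> a ar.
  have := Hd 0 a t a ltac:(lra) ltac:(lra) ltac:(lra) ltac:(lra).
  rewrite Rminus_diag Rminus_0_r Rabs_R0 Rabs_pos_eq; last by lra.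
  have -> : circ z0 0 a = z0 by rewrite /circ !Rmult_0_l !Rplus_0_r C_eta.
  move=> /(_ ltac:(lra) ltac:(lra)) /= /Rabs_def2. lra.
rewrite RInt_const Ic; last by lra.
rewrite /scal /= /mult /=.
have -> : (2 * PI - 0) * (I rho / (4 * PI)) = I rho / 2 by field; lra.
lra.
Qed.

(** * Chebyshev polynomials *)

(** This is [2 T_n (x / 2)] with [T_n] the Chebyshev polynomial of degree [n = 2 ^ k]; it is monic,
    and restricting to powers of two makes it an iterate of one quadratic map. *)
Fixpoint cheb (k : nat) (x : R) : R :=
  match k with O => x | S k => cheb k x ^ 2 - 2 end.

Definition lprod {A : Type} (f : A -> R) (l : list A) : R :=
  fold_right (fun y p => f y * p) 1 l.

Lemma lprod_app {A} (f : A -> R) l1 l2 : lprod f (l1 ++ l2) = lprod f l1 * lprod f l2.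
Proof. elim: l1 => [|y l IH] /=; [ring|rewrite IH; ring]. Qed.

Lemma lprod_ge0 {A} (f : A -> R) l : (forall y, In y l -> 0 <= f y) -> 0 <= lprod f l.
Proof.
elim: l => [|y l IH] H /=; first lra.
apply: Rmult_le_pos; [apply: H; by left|apply: IH => z zl; apply: H; by right].
Qed.

Lemma lprod_le {A} (f g : A -> R) l :
  (forall y, In y l -> 0 <= f y <= g y) -> lprod f l <= lprod g l.
Proof.
elim: l => [|y l IH] H /=; first lra.
have [f0 fg] := H y ltac:(by left).
apply: Rmult_le_compat => //.
  apply: lprod_ge0 => z zl. apply H. by right.
apply: IH => z zl. apply H. by right.
Qed.

Lemma lprod_scal {A} c (f : A -> R) l : lprod (fun y => c * f y) l = c ^ length l * lprod f l.
Proof. elim: l => [|y l IH] /=; [ring|rewrite IH; ring]. Qed.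

Lemma lprod_Rabs {A} (f : A -> R) l : lprod (fun y => Rabs (f y)) l = Rabs (lprod f l).
Proof. elim: l => [|y l IH] /=; [by rewrite Rabs_R1|by rewrite IH Rabs_mult]. Qed.

Lemma lprod_map {A B} (f : B -> R) (u : A -> B) l : lprod f (map u l) = lprod (fun y => f (u y)) l.
Proof. elim: l => [|y l IH] //=; by rewrite IH. Qed.

(** With [u = sqrt (2 + c)], the polynomial [cheb (S k) - c] is the difference of squares
    [(cheb k - u) (cheb k + u)], and [u] stays in [[0, 2]]. The level [c] is arbitrary for the sake
    of this induction. *)
Lemma cheb_factor k : forall c, -2 <= c <= 2 ->
  exists X : list R, (forall y, In y X -> -2 <= y <= 2) /\
    forall x, cheb k x - c = lprod (fun y => x - y) X.
Proof.
elim: k => [|k IH] c cr.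
  exists (c :: nil); split => [y [<-|[]] //|x]; rewrite /=; ring.
have s0 := sqrt_pos (2 + c).
have ss : sqrt (2 + c) * sqrt (2 + c) = 2 + c by apply: sqrt_sqrt; lra.
have s2 : sqrt (2 + c) <= 2 by nra.
have [X [bX pX]] := IH (sqrt (2 + c)) ltac:(lra).
have [Y [bY pY]] := IH (- sqrt (2 + c)) ltac:(lra).
exists (X ++ Y); split.
  move=> y /in_app_iff [] ?; [exact: bX|exact: bY].
move=> x. rewrite lprod_app -pX -pY /=. lra.
Qed.

Lemma cheb_cos k b : cheb k (2 * cos b) = 2 * cos (2 ^ k * b).
Proof.
elim: k => [|k IH]; first by rewrite /= Rmult_1_l.
rewrite /cheb -/cheb IH.
have -> : 2 ^ S k * b = 2 * (2 ^ k * b) by rewrite /=; ring.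
rewrite cos_2a_cos. ring.
Qed.

Lemma cos_lipschitz a b : Rabs (cos a - cos b) <= Rabs (a - b).
Proof.
have [c [cr E]] := MVT_gen cos b a (fun x => - sin x)
  (fun x _ => proj2 (is_derive_Reals cos x (- sin x)) (derivable_pt_lim_cos x))
  (fun x _ => continuity_cos x).
rewrite E Rabs_mult Rabs_Ropp.
have : Rabs (sin c) <= 1 by apply: Rabs_le; have := SIN_bound c; lra.
have := Rabs_pos (a - b). nra.
Qed.

Lemma cos_INR_PI n : Rabs (cos (INR n * PI)) = 1.
Proof.
elim: n => [|n IH]; first by rewrite Rmult_0_l cos_0 Rabs_R1.
rewrite S_INR Rmult_plus_distr_r Rmult_1_l neg_cos Rabs_Ropp. exact: IH.
Qed.

(** The extremal points are [2 cos (j PI / 2 ^ k)]; rounding the angle of [s] down to a multiple of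
    [PI / 2 ^ k] reaches one, and cosine is 1-Lipschitz. *)
Lemma cheb_near k s : -2 <= s <= 2 ->
  exists s', Rabs (s - s') <= 2 * PI / 2 ^ k /\ Rabs (cheb k s') = 2.
Proof.
move=> sr.
have PI0 := PI_RGT_0.
have N0 : 0 < 2 ^ k by apply: pow_lt; lra.
pose b := acos (s / 2).
have cb : cos b = s / 2 by apply: cos_acos; lra.
have [b0 b1] := acos_bound (s / 2).
have x0 : 0 <= 2 ^ k * b / PI.
  apply: Rmult_le_pos; last by apply: Rlt_le; apply: Rinv_0_lt_compat.
  apply: Rmult_le_pos => //; lra.
have [j [j1 j2]] := nfloor_ex _ x0.
exists (2 * cos (INR j * PI / 2 ^ k)); split; last first.
  rewrite cheb_cos.
  have -> : 2 ^ k * (INR j * PI / 2 ^ k) = INR j * PI by field; lra.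
  rewrite Rabs_mult cos_INR_PI Rabs_pos_eq; lra.
have -> : s - 2 * cos (INR j * PI / 2 ^ k) = 2 * (cos b - cos (INR j * PI / 2 ^ k)) by rewrite cb; field; lra.
rewrite Rabs_mult (Rabs_pos_eq 2); last lra.
have := cos_lipschitz b (INR j * PI / 2 ^ k).
have -> : b - INR j * PI / 2 ^ k = (2 ^ k * b / PI - INR j) * (PI / 2 ^ k) by field; lra.
have q0 : 0 < PI / 2 ^ k by exact: Rdiv_lt_0_compat.
rewrite Rabs_mult (Rabs_pos_eq (PI / 2 ^ k)); last lra.
rewrite (Rabs_pos_eq (_ - INR j)); last lra.
have -> : 2 * PI / 2 ^ k = 2 * (PI / 2 ^ k) by field; lra.
nra.
Qed.

(** Compactness of the rectangle: around each point one number serves both as a radius and as a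
    lower bound of [F] within that radius. *)
Lemma positive_bound_2d (F : R -> R -> R) a b c d :
  (forall x y, a <= x <= b -> c <= y <= d -> continuity_2d_pt F x y /\ 0 < F x y) ->
  exists e, 0 < e /\ forall x y, a <= x <= b -> c <= y <= d -> e <= F x y.
Proof.
move=> H.
have [dl Hdl] : exists dl : R * R -> posreal, forall p, a <= fst p <= b -> c <= snd p <= d ->
    forall x y, Rabs (x - fst p) < dl p -> Rabs (y - snd p) < dl p -> dl p < F x y.
  apply: (IndefiniteDescription.functional_choice (fun p (e : posreal) => a <= fst p <= b -> c <= snd p <= d ->
    forall x y, Rabs (x - fst p) < e -> Rabs (y - snd p) < e -> e < F x y)) => -[u v] /=.
  case: (classic (a <= u <= b /\ c <= v <= d)) => [[ur vr]|no]; last first.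
    (* Points outside the rectangle get the arbitrary radius 1. *)
    exists (mkposreal 1 Rlt_0_1) => ? ?; by case: no.
  have [cF pF] := H u v ur vr.
  have e0 : 0 < F u v / 2 by lra.
  have [t Ht] := cF (mkposreal _ e0).
  have m0 : 0 < Rmin t (F u v / 2) by apply: Rmin_glb_lt => //; apply: cond_pos.
  exists (mkposreal _ m0) => _ _ x y /= h1 h2.
  have m1 := Rmin_l t (F u v / 2). have m2 := Rmin_r t (F u v / 2).
  have /= /Rabs_def2 := Ht x y ltac:(lra) ltac:(lra). lra.
have [e He] := compactness_value_2d a b c d (fun u v => dl (u, v)).
exists e; split; first exact: cond_pos.
move=> x y xr yr.
have [u [v [ur [vr [h1 [h2 h3]]]]]] := NNPP _ (He x y xr yr).
have := Hdl (u, v) ur vr x y h1 h2. lra.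
Qed.

(** * The Koebe bound *)

Definition normalized (g : C -> C) : Prop :=
  hol (fun z => Cmod z < 1) g /\ g 0%C = 0%C /\ has_cderiv g 0 1.

Definition injective_on (Om : C -> Prop) (g : C -> C) : Prop :=
  forall z w, Om z -> Om w -> g z = g w -> z = w.

Lemma ccont_Cmod (h : C -> C) z :
  (forall e, 0 < e -> locally z (fun w => Cmod (h w - h z) < e)) -> ccont h z.
Proof.
move=> H; apply/ccont_continuous => P [e He].
apply: filter_imp (H e (cond_pos e)) => w hw. apply: He.
exact: (C_NormedModule_mixin_compat1 (h z) (h w)).
Qed.

Lemma has_cderiv_unique h z d d' : has_cderiv h z d -> has_cderiv h z d' -> d = d'.
Proof.
move=> [[a b] _] [[a' b'] _]. rewrite -(C_eta d) -(C_eta d').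
by rewrite -(is_derive_unique _ _ _ a) -(is_derive_unique _ _ _ a') -(is_derive_unique _ _ _ b) -(is_derive_unique _ _ _ b').
Qed.

Lemma Cminus_0_r (z : C) : (z - 0)%C = z.
Proof. ring. Qed.

(** The singularity at 0 is filled with 1, the derivative there of a [normalized] function. *)
Definition slope (g : C -> C) (z : C) : C :=
  match excluded_middle_informative (z = 0%C) with left _ => 1%C | right _ => (g z / z)%C end.

Lemma slope_0 g : slope g 0 = 1%C.
Proof. by rewrite /slope; case: excluded_middle_informative => // n; case: n. Qed.

Lemma slope_neq0 g (z : C) : z <> 0%C -> slope g z = (g z / z)%C.
Proof. move=> nz; rewrite /slope; case: excluded_middle_informative => // e; by case: nz. Qed.

Lemma hol_ext_on (Om : C -> Prop) f g : (forall z, Om z -> locally z Om) ->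
  (forall z, Om z -> f z = g z) -> hol Om f -> hol Om g.
Proof.
move=> op E [f' H]; exists f' => z Oz.
have L := op z Oz.
have [[c1 c2] [[[a1 a2] [b1 b2]] c']] := H z Oz.
have LE : locally z (fun w => f w = g w) by apply: filter_imp L.
rewrite -{1}(C_eta z) in LE.
have Lx : locally (Re z) (fun t => f (t, Im z) = g (t, Im z)).
  by apply: (locally_2d_1d_const_y (fun x y => f (x, y) = g (x, y))); apply/locally_2d_locally; apply: filter_imp LE => -[].
have Ly : locally (Im z) (fun t => f (Re z, t) = g (Re z, t)).
  by apply: (locally_2d_1d_const_x (fun x y => f (x, y) = g (x, y))); apply/locally_2d_locally; apply: filter_imp LE => -[].
rewrite C_eta in LE.
split; last split => //.
  split; [apply: continuous_ext_loc c1|apply: continuous_ext_loc c2]; by apply: filter_imp LE => w ->.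
split; split; [apply: is_derive_ext_loc a1|apply: is_derive_ext_loc a2|apply: is_derive_ext_loc b1|apply: is_derive_ext_loc b2].
- by apply: filter_imp Lx => w ->.
- by apply: filter_imp Lx => w ->.
- by apply: filter_imp Ly => w ->.
- by apply: filter_imp Ly => w ->.
Qed.

Lemma ccont_slope g : normalized g -> ccont (slope g) 0.
Proof.
move=> [[g' Hg] [g0 d0]]. apply: ccont_Cmod => e e0.
have C0 : Cmod 0 < 1 by rewrite Cmod_0; lra.
have [_ [d0' c0]] := Hg 0%C C0.
have E := has_cderiv_unique _ _ _ _ d0 d0'.
have [] := has_cderiv_cdiff g g' (RtoC 0) _ c0.
  have := locally_Cmod_lt (RtoC 0) (RtoC 0) 1 ltac:(rewrite Cminus_0_r; lra).
  by apply: filter_imp => w; rewrite Cminus_0_r => /Hg [_ []].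
rewrite -E => d1 d2.
(* Each component of [g z - z] is at most [e / 3 * |z|]; passing to the modulus costs a factor
   [sqrt 2 < 2], which stays below [e * |z|]. *)
have e3 : 0 < e / 3 by lra.
have {}d1 := d1 (mkposreal _ e3). have {}d2 := d2 (mkposreal _ e3).
have := filter_and _ _ (proj1 (locally_2d_locally _ _ _) d1) (proj1 (locally_2d_locally _ _ _) d2).
move=> /(_ (@filter_filter _ _ (locally_filter _))) L.
suff K: locally (Re 0%C, Im 0%C) (fun w : C => Cmod (slope g w - slope g 0) < e) by exact: K.
apply: filter_imp L => -[x y] /=.
change (RtoC 0) with (0, 0). rewrite /= -/(RtoC 0) g0 slope_0 /=.
rewrite /Re /Im /= !Rminus_0_r Ropp_0 Rmult_0_l Rmult_1_l Rmult_0_l Rmult_1_l Rplus_0_l Rplus_0_r.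
case: (excluded_middle_informative ((x, y) = 0%C :> C)) => [->|nz] H.
  rewrite slope_0. have -> : (1 - 1 = 0)%C by ring. by rewrite Cmod_0.
have m0 := proj1 (Cmod_gt_0 (x, y)) nz.
rewrite slope_neq0 //.
have -> : (g (x, y) / (x, y) - 1 = (g (x, y) - (x, y)) / (x, y))%C by field.
rewrite Cmod_div //.
apply: (Rmult_lt_reg_r _ _ _ m0).
have -> : Cmod (g (x, y) - (x, y)) / Cmod (x, y) * Cmod (x, y) = Cmod (g (x, y) - (x, y)) by field; lra.
have := Cmod_2Rmax (g (x, y) - (x, y))%C.
have M := Rmax_Cmod (x, y). rewrite /= in M.
have s2 := sqrt2_lt_2.
have s0 := sqrt_pos 2.
have K : Rmax (Rabs (fst (g (x, y) - (x, y))%C)) (Rabs (snd (g (x, y) - (x, y))%C)) <= e / 3 * Cmod (x, y).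
  apply: Rmax_lub; simpl.
    apply: Rle_trans (proj1 H) _. apply: Rmult_le_compat_l => //; lra.
  apply: Rle_trans (proj2 H) _. apply: Rmult_le_compat_l => //; lra.
have := Rmult_le_compat_l _ _ _ s0 K.
have := Rmult_lt_0_compat _ _ e0 m0.
have := Rmult_lt_compat_r _ _ _ (Rmult_lt_0_compat _ _ e3 m0) s2.
lra.
Qed.

Lemma locally_punctured (z0 z : C) r : 0 < Cmod (z - z0) < r ->
  locally z (fun w => 0 < Cmod (w - z0) < r).
Proof. move=> [a b]. apply: filter_and; [exact: locally_Cmod_gt|exact: locally_Cmod_lt]. Qed.

Lemma hol_slope g : normalized g -> hol (fun z => 0 < Cmod (z - 0) < 1) (slope g).
Proof.
move=> [Hg _].
have nz z : 0 < Cmod (z - 0) < 1 -> z <> 0%C by rewrite Cminus_0_r => -[/Cmod_gt_0].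
apply: (hol_ext_on _ (fun z => g z / z)%C).
- move=> z; exact: (locally_punctured 0%C z 1).
- by move=> z /nz /(slope_neq0 g) ->.
- apply: hol_div => //; last exact: hol_id.
  apply: hol_subset Hg => z; rewrite Cminus_0_r; lra.
Qed.

Definition cprod {A : Type} (f : A -> C) (l : list A) : C :=
  fold_right (fun y p => f y * p)%C 1%C l.

Lemma cprod_1 {A} (f : A -> C) l : (forall a, In a l -> f a = 1%C) -> cprod f l = 1%C.
Proof.
elim: l => [|y l IH] H //=.
rewrite H; last by left. rewrite IH; first by toC; ring. move=> z zl; apply: H; by right.
Qed.

Lemma Cmod_cprod {A} (f : A -> C) l : Cmod (cprod f l) = lprod (fun a => Cmod (f a)) l.
Proof. elim: l => [|y l IH] /=; first exact: Cmod_1. by rewrite Cmod_mult IH. Qed.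

Lemma lprod_mult {A} (f g : A -> R) l : lprod (fun a => f a * g a) l = lprod f l * lprod g l.
Proof. elim: l => [|y l IH] /=; [ring|rewrite IH; ring]. Qed.

Lemma lprod_eq {A} (f g : A -> R) l : (forall a, In a l -> f a = g a) -> lprod f l = lprod g l.
Proof.
elim: l => [|y l IH] H //=. rewrite H; last by left. rewrite IH // => z zl; apply: H; by right.
Qed.

Lemma lprod_1 {A} (l : list A) : lprod (fun _ => 1) l = 1.
Proof. elim: l => [|y l IH] //=; rewrite IH; ring. Qed.

Lemma hol_cprod {A} Om (F : C -> A -> C) l : (forall a, In a l -> hol Om (fun z => F z a)) ->
  hol Om (fun z => cprod (F z) l).
Proof.
elim: l => [|y l IH] H /=; first exact: hol_const.
apply: hol_mult; [apply: H; by left|apply: IH => z zl; apply: H; by right].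
Qed.

Lemma ccont_cprod {A} z0 (F : C -> A -> C) l : (forall a, In a l -> ccont (fun z => F z a) z0) ->
  ccont (fun z => cprod (F z) l) z0.
Proof.
elim: l => [|y l IH] H /=; first exact: ccont_const.
apply: ccont_mult; [apply: H; by left|apply: IH => z zl; apply: H; by right].
Qed.

Lemma Cmod_circ0 t a : 0 <= t -> Cmod (circ 0 t a) = t.
Proof. move=> t0. by rewrite -{1}(Cminus_0_r (circ 0 t a)) Cmod_circ Rabs_pos_eq. Qed.

Lemma univalent_neq0 g z : normalized g -> injective_on (fun z => Cmod z < 1) g ->
  0 < Cmod z < 1 -> g z <> 0%C.
Proof.
move=> [_ [g0 _]] inj [z0 z1]. rewrite -g0 => /inj E.
have Ez : z = 0%C by apply: E => //; rewrite Cmod_0; lra.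
rewrite Ez Cmod_0 in z0; lra.
Qed.

(** Off the origin the factor [slope g z * (c / (c - g z))] is the inverse of [z (1 / g z - 1 / c)],
    and at the origin it is 1. Hence the product [q] of these factors has modulus at least 1
    somewhere on the circle of radius [rho']. *)
Lemma product_on_circle g rho' rho (l : list R) :
  normalized g -> injective_on (fun z => Cmod z < 1) g -> 0 < rho' < rho -> rho < 1 ->
  exists b, 0 <= b <= 2 * PI /\
    rho' ^ length l * lprod (fun a => Cmod (/ g (circ 0 rho' b) - / g (circ 0 rho a))) l <= 1.
Proof.
move=> ng inj [r0 rr] r1.
pose c a := g (circ 0 rho a).
have ca a : c a <> 0%C by apply: univalent_neq0 => //; rewrite Cmod_circ0; lra.
(* Univalence: a value attained on the circle of radius [rho] is not attained inside it, so [q] has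
   no poles there. *)
have cg z a : Cmod z < rho -> (c a - g z)%C <> 0%C.
  move=> zr E. have : c a = g z by rewrite -(Cplus_0_r (g z)) -E; ring.
  move/inj => E'. have := E' ltac:(rewrite Cmod_circ0; lra) ltac:(lra).
  move=> /(f_equal Cmod). rewrite Cmod_circ0; lra.
pose q z := cprod (fun a => slope g z * (c a / (c a - g z)))%C l.
have Hg : hol (fun z => 0 < Cmod (z - 0) < rho) g.
  apply: hol_subset (proj1 ng) => z; rewrite Cminus_0_r; lra.
have hq : hol (fun z => 0 < Cmod (z - 0) < rho) q.
  apply: hol_cprod => a _. apply: hol_mult.
    apply: hol_subset (hol_slope _ ng) => z. lra.
  apply: hol_div; [|exact: hol_const|apply: hol_minus => //; exact: hol_const].
  move=> z; rewrite Cminus_0_r => ?; apply: cg; lra.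
have g0 : g 0%C = 0%C by apply ng.
have q0 : q 0%C = 1%C.
  apply: cprod_1 => a _. rewrite slope_0 g0 Cminus_0_r. by field.
have cq : ccont q 0.
  apply: ccont_cprod => a _. apply: ccont_mult; first exact: ccont_slope.
  have C0 : Cmod 0 < rho by rewrite Cmod_0; lra.
  apply: (hol_ccont (fun z => Cmod z < rho)) => //.
  apply: hol_div; [|exact: hol_const|apply: hol_minus; first exact: hol_const].
    move=> z ?; apply: cg; lra.
  apply: hol_subset (proj1 ng) => z. lra.
(* As [1 - q] vanishes at the centre, [Re q >= 1] at some point of the circle. *)
have [b [br Hb]] : exists a, 0 <= a <= 2 * PI /\ Re (1 - q (circ 0 rho' a))%C <= 0.
  apply: (circle_principle (fun z => 1 - q z)%C 0 rho rho') => //.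
  - apply: hol_minus => //; exact: hol_const.
  - apply: (ccont_plus (fun _ => 1%C) (fun z => - q z)%C); first exact: ccont_const.
    split; apply: continuous_opp; apply cq.
  - rewrite q0. have -> : (1 - 1 = 0)%C by ring. by rewrite /=; lra.
exists b; split => //.
set z := circ 0 rho' b in Hb *.
have mz : Cmod z = rho' by rewrite /z Cmod_circ0; lra.
have z0 : z <> 0%C by apply/Cmod_gt_0; rewrite mz.
have gz : g z <> 0%C by apply: univalent_neq0 => //; lra.
have Mq : 1 <= Cmod (q z).
  have := re_le_Cmod (q z). have := Rle_abs (Re (q z)). move: Hb; cfold; lra.
rewrite -lprod_scal.
set P := lprod _ l.
have P0 : 0 <= P by apply: lprod_ge0 => a _; apply: Rmult_le_pos; [lra|exact: Cmod_ge_0].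
have E : Cmod (q z) * P = 1.
  rewrite /q Cmod_cprod /P -lprod_mult -(lprod_1 l). apply: lprod_eq => a _.
  rewrite -mz -!Cmod_mult -/(c a) slope_neq0 //.
  have -> : (g z / z * (c a / (c a - g z)) * (z * (/ g z - / c a)) = 1)%C.
    field. do !split => //. apply: cg; lra.
  exact: Cmod_1.
nra.
Qed.

Lemma Cminus_eq0 (u v : C) : (u - v = 0)%C -> u = v.
Proof. move=> E. have -> : u = (u - v + v)%C by ring. rewrite E. ring. Qed.

Lemma Cmod_minus_sym (z w : C) : Cmod (z - w) = Cmod (w - z).
Proof. rewrite -Cmod_opp. f_equal. ring. Qed.

Lemma Cmod_triangle_rev (u v : C) : Rabs (Cmod u - Cmod v) <= Cmod (u - v).
Proof.
apply: Rabs_le; split.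
  have := Cmod_triangle u (v - u).
  have -> : (u + (v - u) = v)%C by ring. rewrite (Cmod_minus_sym v u). lra.
have := Cmod_triangle v (u - v). have -> : (v + (u - v) = u)%C by ring. lra.
Qed.

(** Lowering [a] to [L] takes it no further from a point [c] below [L]. This keeps a distance within
    the interval that carries the Chebyshev nodes. *)
Lemma Rmin_contract a b c L : c <= L -> Rabs (a - c) <= b -> Rabs (Rmin a L - c) <= b.
Proof.
move=> cL. rewrite /Rmin; case: Rle_dec => // aL.
move/Rabs_le_between => H. apply/Rabs_le_between; lra.
Qed.

Lemma continuous_Cmod (h : C -> C) z : ccont h z -> continuous (fun w => Cmod (h w)) z.
Proof.
move=> [a b]. rewrite /Cmod.
apply: (continuous_comp (fun w => fst (h w) ^ 2 + snd (h w) ^ 2) sqrt).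
  apply: (continuous_ext (fun s => fst (h s) * fst (h s) + snd (h s) * snd (h s))); first by move=> t; toR; simpl; ring.
  by apply: continuous_plus; apply: continuous_mult.
exact: continuous_sqrt.
Qed.

Lemma ccont_circ (h : C -> C) z0 t a : ccont h (circ z0 t a) ->
  ccont (fun p : C => h (circ z0 (fst p) (snd p))) (t, a).
Proof.
move=> H. apply: (ccont_comp (fun p : C => circ z0 (fst p) (snd p)) h) => //.
apply/ccont_continuous. exact: continuous_circ.
Qed.

Lemma continuity_2d_mod_diff (h k : C -> C) t r a b : ccont h (circ 0 t a) -> ccont k (circ 0 r b) ->
  continuity_2d_pt (fun a b => Cmod (h (circ 0 t a) - k (circ 0 r b))) a b.
Proof.
move=> H K. apply/continuity_2d_pt_filterlim.
have c1 : continuous (fun p : C => ((t, fst p) : C)) (a, b).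
  apply/ccont_continuous; split; [exact: continuous_const|exact: continuous_fst].
have c2 : continuous (fun p : C => ((r, snd p) : C)) (a, b).
  apply/ccont_continuous; split; [exact: continuous_const|exact: continuous_snd].
apply: (continuous_Cmod (fun p : C => h (circ 0 t (fst p)) - k (circ 0 r (snd p)))%C (a, b)).
apply: ccont_plus.
  apply: (ccont_comp (fun p : C => ((t, fst p) : C)) (fun p : C => h (circ 0 (fst p) (snd p)))); first exact/ccont_continuous.
  exact: ccont_circ.
suff [c3 c4] : ccont (fun p : C => k (circ 0 r (snd p))) (a, b) by split; apply: continuous_opp.
apply: (ccont_comp (fun p : C => ((r, snd p) : C)) (fun p : C => k (circ 0 (fst p) (snd p)))); first exact/ccont_continuous.
exact: ccont_circ.
Qed.

Lemma pow2_unbounded x : exists k, x <= 2 ^ k.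
Proof.
have [n Hn] := nfloor_ex (Rabs x) (Rabs_pos x).
exists (S n). have := Rle_abs x.
have : INR n + 1 <= 2 ^ S n.
  rewrite -S_INR. elim: (S n) => [|m IH]; first by rewrite /=; lra.
  rewrite S_INR /=. have : 1 <= 2 ^ m by apply: pow_R1_Rle; lra. lra.
lra.
Qed.

(** No limit in the degree is taken: if [L rho > 4], a smaller radius [rho'] still has
    [L / 4 * rho' > 1], and this slack lets a single Chebyshev polynomial of high degree produce
    [2 <= 1]. *)
Lemma koebe_on_circle g a0 rho :
  normalized g -> injective_on (fun z => Cmod z < 1) g -> 0 < rho < 1 ->
  rho <= 4 * Cmod (g (circ 0 rho a0)).
Proof.
move=> ng inj [r0 r1].
have cmz t a : 0 < t < 1 -> 0 < Cmod (circ 0 t a) < 1 by move=> ?; rewrite Cmod_circ0; lra.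
have gn t a : 0 < t < 1 -> g (circ 0 t a) <> 0%C by move=> ?; apply: univalent_neq0 => //; exact: cmz.
pose phi z := (/ g z)%C.
have cphi t a : 0 < t < 1 -> ccont phi (circ 0 t a).
  move=> tr. apply: ccont_inv; first exact: gn.
  apply: (hol_ccont _ _ _ (proj1 ng)). apply cmz => //.
pose p := phi (circ 0 rho a0).
have gm : 0 < Cmod (g (circ 0 rho a0)) by apply/Cmod_gt_0; apply: gn.
have pm : Cmod p = / Cmod (g (circ 0 rho a0)) by rewrite /p /phi Cmod_inv //; apply: gn.
set L := Cmod p.
have L0 : 0 < L by rewrite /L pm; apply: Rinv_0_lt_compat.
suff : L * rho <= 4.
  rewrite /L pm => H. have := Rmult_le_compat_r _ _ _ (Rlt_le _ _ gm) H.
  have -> : / Cmod (g (circ 0 rho a0)) * rho * Cmod (g (circ 0 rho a0)) = rho by field; lra. lra.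
have p0 : p <> 0%C by apply/Cmod_gt_0.
(* The mean of [p g] over the circle is [p g(0) = 0]. *)
have [a1 [_ Ha1]] : exists a, 0 <= a <= 2 * PI /\ Re (p * g (circ 0 rho a))%C <= 0.
  apply: (circle_principle (fun z => p * g z)%C 0 1 rho) => //.
  - apply: hol_mult; first exact: hol_const.
    apply: hol_subset (proj1 ng) => z; rewrite Cminus_0_r; lra.
  - apply: ccont_mult; first exact: ccont_const.
    apply: (hol_ccont _ _ _ (proj1 ng)). rewrite Cmod_0; lra.
  - have -> : g 0%C = 0%C by apply ng. rewrite Cmult_0_r /=; lra.
(* [Re (p w) <= 0] gives [|1 - p w| >= |p w|]; dividing by [|w|] yields [|1 / w - p| >= |p|]. *)
have far : L <= Cmod (phi (circ 0 rho a1) - p).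
  have gn1 := gn rho a1 ltac:(lra).
  rewrite /L /phi. set w := g (circ 0 rho a1) in gn1 Ha1 *.
  apply: Rsqr_incr_0_var; last exact: Cmod_ge_0.
  have -> : (/ w - p)%C = ((1 - p * w) / w)%C by field.
  have wm := proj1 (Cmod_gt_0 w) gn1.
  rewrite Cmod_div //.
  have K : Cmod (p * w) <= Cmod (1 - p * w).
    apply: sqrt_le_1_alt. move: Ha1. cfold. nra.
  rewrite Cmod_mult in K.
  have : Cmod p <= Cmod (1 - p * w) / Cmod w by apply/Rle_div_r.
  move=> H. have := Cmod_ge_0 p. rewrite /Rsqr; nra.
(* Intermediate values: between the angles [a0] and [a1] the distance to [p] goes from 0 to at least
   [L]. *)
have node x : 0 <= x <= L -> exists a, Rmin a0 a1 <= a <= Rmax a0 a1 /\ Cmod (phi (circ 0 rho a) - p) = x.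
  move=> xr.
  have [||a [ar ax]] := IVT_gen (fun a => Cmod (phi (circ 0 rho a) - p)) a0 a1 x.
  - move=> a. apply/continuity_pt_filterlim.
    have H := continuity_2d_mod_diff (fun _ => p) phi rho rho 0 a (ccont_const _ _) (cphi rho a ltac:(lra)).
    have := continuity_2d_pt_r _ _ _ H.
    by apply: continuous_ext => t; rewrite Cmod_minus_sym.
  - rewrite -/p. have -> : (p - p = 0)%C by ring. rewrite Cmod_0.
    rewrite Rmin_left; last by apply: Cmod_ge_0. rewrite Rmax_right; last by apply: Cmod_ge_0. lra.
  - by exists a.
case: (Rle_lt_dec (L * rho) 4) => // H4.
(* The midpoint of [4 / L] and [rho], so that [L / 4 * rho'] exceeds 1. *)
pose rho' := (4 / L + rho) / 2.
have q4 : 0 < 4 / L by apply: Rdiv_lt_0_compat; lra.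
have q4' : 4 / L < rho by apply/Rlt_div_l => //; lra.
have r'0 : 0 < rho' < rho by rewrite /rho'; lra.
have M1 : 1 < L / 4 * rho'.
  have E : L / 4 * rho' = (1 + L / 4 * rho) / 2 by rewrite /rho'; field; lra.
  rewrite E; lra.
(* By univalence the two image curves are disjoint, and by compactness their distance is
   positive. *)
have [d [d0 Hd]] : exists d, 0 < d /\ forall b a, 0 <= b <= 2 * PI -> Rmin a0 a1 <= a <= Rmax a0 a1 ->
    d <= Cmod (phi (circ 0 rho' b) - phi (circ 0 rho a)).
  apply: positive_bound_2d => b a _ _; split.
    apply: continuity_2d_mod_diff; apply: cphi; lra.
  apply/Cmod_gt_0 => E.
  have E1 : phi (circ 0 rho' b) = phi (circ 0 rho a).
    exact: Cminus_eq0.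
  have E2 : g (circ 0 rho' b) = g (circ 0 rho a).
    have n1 := gn rho' b ltac:(lra). have n2 := gn rho a ltac:(lra).
    transitivity (/ / g (circ 0 rho' b))%C; first by field.
    rewrite -/(phi _) E1 /phi. by field.
  have := inj _ _ (proj2 (cmz rho' b ltac:(lra))) (proj2 (cmz rho a ltac:(lra))) E2.
  move=> /(f_equal Cmod). rewrite !Cmod_circ0; lra.
have PI0 := PI_RGT_0.
(* [k] is so large that the spacing of the extremal points, rescaled to [[0, L]], fits into the
   slack [d * (L / 4 * rho' - 1)]. *)
have [k Hk] := pow2_unbounded (L / 4 * (2 * PI) / (d * (L / 4 * rho' - 1))).
have K0 : 0 < 2 ^ k by apply: pow_lt; lra.
have eta_small : L / 4 * (2 * PI / 2 ^ k) <= d * (L / 4 * rho' - 1).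
  have dm : 0 < d * (L / 4 * rho' - 1) by apply: Rmult_lt_0_compat; lra.
  move/Rle_div_l: Hk => /(_ dm) Hk.
  have -> : L / 4 * (2 * PI / 2 ^ k) = L / 4 * (2 * PI) / 2 ^ k by field; lra.
  apply/Rle_div_l => //; lra.
(* The nodes are the zeros [y] of [cheb k], carried from [[-2, 2]] to [[0, L]] by
   [L / 4 * (y + 2)]. *)
have [X [bX pX]] := cheb_factor k 0 ltac:(lra).
have [u Hu] : exists u : R -> R, forall y, -2 <= y <= 2 ->
    Rmin a0 a1 <= u y <= Rmax a0 a1 /\ Cmod (phi (circ 0 rho (u y)) - p) = L / 4 * (y + 2).
  apply: (functional_choice (fun y a => -2 <= y <= 2 ->
    Rmin a0 a1 <= a <= Rmax a0 a1 /\ Cmod (phi (circ 0 rho a) - p) = L / 4 * (y + 2))) => y.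
  case: (classic (-2 <= y <= 2)) => yr; last by exists 0.
  have [|a Ha] := node (L / 4 * (y + 2)); first by nra.
  by exists a.
have [b [br Hb]] := product_on_circle g rho' rho (map u X) ng inj r'0 r1.
rewrite lprod_map length_map -lprod_scal in Hb.
(* Truncation at [L] makes [4 / L * t - 2] a point of [[-2, 2]], close to an extremal point [s']. *)
pose t := Rmin (Cmod (phi (circ 0 rho' b) - p)) L.
have tr : 0 <= t <= L.
  split; last exact: Rmin_r. apply: Rmin_glb; [exact: Cmod_ge_0|lra].
have [|s' [ss Hs]] := cheb_near k (4 / L * t - 2).
  have E : 4 / L * L = 4 by field; lra. nra.
(* Moving from [4 / L * t - 2] to [s'] costs at most the slack, which [d <= D'] pays for. *)
have low y : In y X -> Rabs (s' - y) <= (rho' * Cmod (/ g (circ 0 rho' b) - / g (circ 0 rho (u y)))).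
  move=> /bX yr. have [ur uy] := Hu y yr.
  rewrite -/(phi (circ 0 rho' b)) -/(phi (circ 0 rho (u y))).
  have D := Hd b (u y) br ur. set D' := Cmod _ in D *.
  have A : Rabs (t - L / 4 * (y + 2)) <= D'.
    apply: Rmin_contract; first by nra.
    rewrite -uy. apply: Rle_trans (Cmod_triangle_rev _ _) _.
    right. rewrite /D'. f_equal. ring.
  have B : L / 4 * Rabs (4 / L * t - 2 - y) <= D'.
    rewrite -(Rabs_pos_eq (L / 4)); last lra. rewrite -Rabs_mult.
    have -> : L / 4 * (4 / L * t - 2 - y) = t - L / 4 * (y + 2) by field; lra. done.
  have T : Rabs (s' - y) <= Rabs (4 / L * t - 2 - s') + Rabs (4 / L * t - 2 - y).
    have := Rabs_triang (- (4 / L * t - 2 - s')) (4 / L * t - 2 - y).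
    rewrite Rabs_Ropp. by have -> : - (4 / L * t - 2 - s') + (4 / L * t - 2 - y) = s' - y by ring.
  have U : L / 4 * Rabs (s' - y) <= L / 4 * rho' * D'.
    have := Rmult_le_compat_l (L / 4) _ _ ltac:(lra) T.
    have := Rmult_le_compat_l (L / 4) _ _ ltac:(lra) ss.
    nra.
  nra.
(* [|cheb k s'| = 2] is the product of the [|s' - y|], bounded factor by factor by the product that
   is at most 1. *)
have : 2 <= 1.
  rewrite -Hs -(Rminus_0_r (cheb k s')) pX -lprod_Rabs.
  apply: Rle_trans Hb. apply: lprod_le => y yX; split; [exact: Rabs_pos|exact: low].
lra.
Qed.

(** * Zeros of the symmetrization *)

(** The Schwarz reflection [g^]: conjugating twice preserves holomorphy. *)
Definition reflect (g : C -> C) (z : C) : C := Cconj (g (Cconj z)).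

Lemma ccont_conj z : ccont Cconj z.
Proof. split; [exact: continuous_fst|apply: continuous_opp; exact: continuous_snd]. Qed.

Lemma hol_reflect (Om : C -> Prop) g : (forall z, Om z -> Om (Cconj z)) -> hol Om g -> hol Om (reflect g).
Proof.
move=> sym [g' H]; exists (reflect g') => z Oz.
have [c [[[a1 a2] [b1 b2]] c']] := H _ (sym z Oz).
have cc (k : C -> C) : ccont k (Cconj z) -> ccont (reflect k) z.
  move=> ck. apply: (ccont_comp (fun w => k (Cconj w)) Cconj); last exact: ccont_conj.
  apply: (ccont_comp Cconj k) => //. exact: ccont_conj.
split; first exact: cc. split; last exact: cc.
have neg (f : R -> R) x l : is_derive f (- x) l -> is_derive (fun s => f (- s)) x (- l).
  move=> D. have := is_derive_comp f Ropp x l (-1) D (is_derive_Ropp _ _ 1 (is_derive_id x)).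
  move=> {}D. apply: is_derive_eq D _. rewrite /scal /= /mult /=. ring.
split; split.
- exact: a1.
- apply: is_derive_Ropp a2.
- apply: (is_derive_eq _ _ (- Re (Ci * g' (Cconj z)))); last by rewrite /reflect; cfold; ring.
  apply: (neg (fun s => Re (g (Re z, s)))). exact: b1.
- apply: (is_derive_eq _ _ (- - Im (Ci * g' (Cconj z)))); last by rewrite /reflect; cfold; ring.
  apply: is_derive_Ropp. apply: (neg (fun s => Im (g (Re z, s)))). exact: b2.
Qed.

Lemma reflect_circ g t a : reflect g (circ 0 t a) = Cconj (g (circ 0 t (- a))).
Proof.
rewrite /reflect. do 2!f_equal. rewrite /circ /Cconj /= cos_neg sin_neg. f_equal. ring.
Qed.

(** The function whose zero is sought is [X - Y], and [X 0 = 0]; so [(X + Y) / (X - Y)] is -1 at the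
    centre, while its real part is positive wherever [|Y| < |X|]. *)
Lemma symmetrization_zero g (a : C) b :
  normalized g -> injective_on (fun z => Cmod z < 1) g ->
  0 <= b -> Cmod a ^ 2 + b < / 16 ->
  exists z, Cmod z < 1 /\ ((g z - a) * (reflect g z - Cconj a) + RtoC b = 0)%C.
Proof.
move=> ng inj b0 ab. apply: NNPP => no.
pose X z := ((g z - a) * reflect g z)%C.
pose Y z := (Cconj a * g z - RtoC (Cmod a ^ 2 + b))%C.
have XY z : (X z - Y z = (g z - a) * (reflect g z - Cconj a) + RtoC b)%C.
  rewrite /X /Y RtoC_plus Cmod2_conj. ring.
have nz z : Cmod z < 1 -> (X z - Y z)%C <> 0%C.
  move=> z1 E. apply: no. exists z. by rewrite -XY.
have g0 : g 0%C = 0%C by apply ng.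
have hg := proj1 ng.
have hr : hol (fun z => Cmod z < 1) (reflect g).
  apply: hol_reflect hg => z. by rewrite Cmod_conj.
have hX : hol (fun z => Cmod z < 1) X.
  apply: hol_mult => //. apply: hol_minus => //. exact: hol_const.
have hY : hol (fun z => Cmod z < 1) Y.
  apply: hol_minus; last exact: hol_const. apply: hol_mult => //. exact: hol_const.
have hG : hol (fun z => Cmod z < 1) (fun z => (X z + Y z) / (X z - Y z))%C.
  apply: hol_div => //; [exact: hol_plus|exact: hol_minus].
have C0 : Cmod 0 < 1 by rewrite Cmod_0; lra.
have X0 : X 0%C = 0%C.
  rewrite /X /reflect. have -> : Cconj 0 = 0%C by apply: injective_projections => /=; lra.
  rewrite g0. apply: injective_projections => /=; ring.
have N0 := nz 0%C C0.
have G0 : Re ((X 0%C + Y 0%C) / (X 0%C - Y 0%C))%C = -1.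
  rewrite X0 in N0 *.
  have -> : ((0 + Y 0%C) / (0 - Y 0%C) = - (1))%C.
    move: N0. generalize (Y 0%C) => y N0. have -> : (0 + y = - (1) * (0 - y))%C by ring.
    rewrite /Cdiv -Cmult_assoc Cinv_r //. ring.
  by [].
pose s := sqrt (Cmod a ^ 2 + b).
have s2 : s * s = Cmod a ^ 2 + b by apply: sqrt_sqrt; nra.
have s0 : 0 <= s by exact: sqrt_pos.
have s4 : 4 * s < 1 by nra.
(* Any radius between [4 s] and 1 would do: the Koebe bound then gives [|g| > s] on the circle. *)
pose r := (1 + 4 * s) / 2.
have r1 : 4 * s < r < 1 by rewrite /r; lra.
have [t [_ Ht]] : exists t, 0 <= t <= 2 * PI /\ Re ((fun z => (X z + Y z) / (X z - Y z))%C (circ 0 r t)) <= 0.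
  apply: (circle_principle (fun z => (X z + Y z) / (X z - Y z))%C 0 1 r); [| |lra|rewrite G0; lra].
    apply: hol_subset hG => z; rewrite Cminus_0_r; lra.
  exact: (hol_ccont _ _ _ hG).
have Ku := koebe_on_circle g t r ng inj ltac:(lra).
(* The reflected function at angle [t] is the conjugate of [g] at angle [- t]. *)
have Kv := koebe_on_circle g (- t) r ng inj ltac:(lra).
rewrite -Cmod_conj -reflect_circ in Kv.
have Nr := nz (circ 0 r t) ltac:(rewrite Cmod_circ0; lra).
set u := g (circ 0 r t) in Ku. set v := reflect g (circ 0 r t) in Kv.
have su : s < Cmod u by lra. have sv : s < Cmod v by lra.
(* The Moebius map [u |-> (conj a u - s^2) / (u - a)] sends [|u| > s] into [|v| < s]. *)
have YX : Cmod (Y (circ 0 r t)) ^ 2 < Cmod (X (circ 0 r t)) ^ 2.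
  rewrite /X /Y -/u -/v -s2 Cmod_mult.
  have M (w : C) : Cmod w ^ 2 = fst w ^ 2 + snd w ^ 2 by exact: Cmod2_alt.
  have -> : (Cmod (u - a) * Cmod v) ^ 2 = Cmod (u - a) ^ 2 * Cmod v ^ 2 by ring.
  have am : Cmod a <= s by apply: Rsqr_incr_0_var => //; rewrite /Rsqr; nra.
  have a0 := Cmod_ge_0 a.
  have ua : 0 < Cmod (u - a).
    have := Cmod_triangle_rev u a. have := Rle_abs (Cmod u - Cmod a). lra.
  have I1 : Cmod (Cconj a * u - RtoC (s * s)) ^ 2 + (s ^ 2 - Cmod a ^ 2) * (Cmod u ^ 2 - s ^ 2) = Cmod (u - a) ^ 2 * s ^ 2.
    rewrite !M. case: (u) => u1 u2. case: (a) => a1 a2. cfold. ring.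
  have : 0 <= (s ^ 2 - Cmod a ^ 2) * (Cmod u ^ 2 - s ^ 2).
    apply: Rmult_le_pos; nra.
  have : Cmod (u - a) ^ 2 * s ^ 2 < Cmod (u - a) ^ 2 * Cmod v ^ 2.
    apply: Rmult_lt_compat_l; nra.
  lra.
(* In coordinates, [Re ((x + y) / (x - y)) = (|x|^2 - |y|^2) / |x - y|^2]. *)
move: Ht YX (sumsq_neq0 _ Nr). rewrite !Cmod2_alt.
set x := X _. set y := Y _. case: x => x1 x2. case: y => y1 y2.
cfold => H1 H2 N.
have D : 0 < (x1 + - y1) * ((x1 + - y1) * 1) + (x2 + - y2) * ((x2 + - y2) * 1).
  have := pow2_ge_0 (x1 + - y1). have := pow2_ge_0 (x2 + - y2). simpl. lra.
have P : 0 < x1 ^ 2 + x2 ^ 2 - y1 ^ 2 - y2 ^ 2 by simpl; lra.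
have := Rdiv_lt_0_compat _ _ P D.
move: H1 D. set d := (x1 + - y1) * ((x1 + - y1) * 1) + (x2 + - y2) * ((x2 + - y2) * 1) => H1 D.
have -> : (x1 ^ 2 + x2 ^ 2 - y1 ^ 2 - y2 ^ 2) / d = (x1 + y1) * ((x1 + - y1) / d) - (x2 + y2) * (- (x2 + - y2) / d) by field; lra.
lra.
Qed.

(** * The identity principle *)

Lemma hol_pow Om f n : hol Om f -> hol Om (fun z => f z ^ n)%C.
Proof.
move=> H; elim: n => [|n IH]; first exact: hol_const.
apply: (hol_ext _ (fun z => f z * f z ^ n)%C) => //. exact: hol_mult.
Qed.

Lemma circ_minus z0 t a : (circ z0 t a - z0 = RtoC t * (cos a, sin a))%C.
Proof. apply: injective_projections; cfold; ring. Qed.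

(** This takes the place of power series in the identity principle. The arc has midpoint direction
    [e] and half-opening of cosine [kappa]. If [h z0] were nonzero, the circle principle for
    [1 - h W^n / h z0] would bound [|h z0|^2] by [M^2 (1 - gam)^n] for every [n]. *)
Lemma zero_from_arc (h : C -> C) (z0 e : C) (r s kappa : R) :
  hol (fun z => Cmod (z - z0) < r) h -> 0 < s < r -> Cmod e = 1 -> 0 <= kappa < 1 ->
  (forall a, kappa < Re ((cos a, sin a) * Cconj e)%C -> h (circ z0 s a) = 0%C) ->
  h z0 = 0%C.
Proof.
move=> hh [s0 sr] e1 [k0 k1] arc. apply: NNPP => hz0.
have e2 : fst e ^ 2 + snd e ^ 2 = 1 by have := Cmod2_alt e; rewrite e1 /Re /Im; lra.
(* Powers of the weight [W] (value 1 at [z0], modulus at most some [tau < 1] off the arc) damp [h]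
   on the part of the circle where it need not vanish. *)
pose mu := (1 - kappa) / 4.
have mu0 : 0 < mu by rewrite /mu; lra.
have muk : (1 + 2 * mu) * kappa < 1 by rewrite /mu; nra.
(* [W] has a pole at [z0 + b e] and a zero at [z0 + d e], both beyond the circle in the direction of
   the arc. The inequality [(1 + 2 mu) kappa < 1] is what makes [|W| < 1] off the arc. *)
pose b := s * (1 + mu). pose d := s * (1 + 2 * mu).
have sb : s < b by rewrite /b; nra.
have bd : b < d by rewrite /b /d; nra.
pose W z := ((RtoC (b / d)) * ((RtoC d * e - (z - z0)) / (RtoC b * e - (z - z0))))%C.
pose r' := Rmin r b.
have r's : s < r' by apply: Rmin_glb_lt.
have nz z : Cmod (z - z0) < r' -> (RtoC b * e - (z - z0))%C <> 0%C.
  move=> zr. apply/Cmod_gt_0.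
  have := Cmod_triangle_rev (RtoC b * e) (z - z0).
  rewrite Cmod_mult e1 Cmod_R (Rabs_pos_eq b); last lra.
  have := Rmin_r r b. rewrite -/r'. have := Rle_abs (b * 1 - Cmod (z - z0)). lra.
have hW : hol (fun z => Cmod (z - z0) < r') W.
  apply: hol_mult; first exact: hol_const.
  have hd : hol (fun z => Cmod (z - z0) < r') (fun z => z - z0)%C.
    apply: hol_minus; [exact: hol_id|exact: hol_const].
  apply: hol_div; first exact: nz.
    apply: hol_minus; [exact: hol_const|exact: hd].
  apply: hol_minus; [exact: hol_const|exact: hd].
have e0 : e <> 0%C by apply/Cmod_gt_0; rewrite e1; lra.
have W0 : W z0 = 1%C.
  rewrite /W. have -> : (z0 - z0 = 0)%C by ring.
  have b0 : RtoC b <> 0%C by move=> /RtoC_inj; lra.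
  have d0 : RtoC d <> 0%C by move=> /RtoC_inj; lra.
  rewrite RtoC_div; last lra. field. by split.
(* A lower bound of [1 - |W|^2] off the arc: with [N], [D] the moduli in the quotient [W],
   [d^2 D^2 - b^2 N^2 >= mu^2 s^4] and [D <= s (2 + mu)]. *)
pose gam := mu ^ 2 / ((1 + 2 * mu) ^ 2 * (2 + mu) ^ 2).
have gam0 : 0 < gam.
  apply: Rdiv_lt_0_compat; first by apply: pow_lt.
  apply: Rmult_lt_0_compat; apply: pow_lt; lra.
have Wsmall a : Re ((cos a, sin a) * Cconj e)%C <= kappa -> Cmod (W (circ z0 s a)) ^ 2 <= 1 - gam.
  set c := Re _ => ck.
  have cs : cos a * cos a + sin a * sin a = 1 by have := sin2_cos2 a; rewrite /Rsqr; lra.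
  have cE : c = cos a * fst e + sin a * snd e by rewrite /c; cfold; ring.
  have c1 : -1 <= c.
    rewrite cE. have := pow2_ge_0 (cos a + fst e). have := pow2_ge_0 (sin a + snd e).
    move: e2 => /=. lra.
  have dist t : Cmod (RtoC t * e - (circ z0 s a - z0)) ^ 2 = t * t + s * s - 2 * t * s * c.
    rewrite circ_minus Cmod2_alt cE. move: e2 cs. case: (e) => x y /= e2 cs. cfold.
    transitivity (t * t * (x * (x * 1) + y * (y * 1)) + s * s * (cos a * cos a + sin a * sin a) - 2 * t * s * (cos a * x + sin a * y)); first ring.
    rewrite e2 cs. ring.
  rewrite /W Cmod_mult Cmod_div; last by apply: nz; rewrite Cmod_circ Rabs_pos_eq; lra.
  rewrite Cmod_R Rabs_pos_eq; last by apply: Rlt_le; apply: Rdiv_lt_0_compat; lra.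
  set N := Cmod (RtoC d * e - _). set D := Cmod (RtoC b * e - _).
  have N2 : N ^ 2 = d * d + s * s - 2 * d * s * c by exact: dist.
  have D2 : D ^ 2 = b * b + s * s - 2 * b * s * c by exact: dist.
  have D0 : 0 < D by apply/Cmod_gt_0; apply: nz; rewrite Cmod_circ Rabs_pos_eq; lra.
  have -> : (b / d * (N / D)) ^ 2 = b * b * N ^ 2 / (d * d * D ^ 2) by field; lra.
  have dD : 0 < d * d * D ^ 2.
    apply: Rmult_lt_0_compat; [nra|exact: pow_lt].
  apply/Rle_div_l => //.
  have bs : 0 < b * s by nra.
  have Dle : D ^ 2 <= (s * (2 + mu)) ^ 2.
    have -> : (s * (2 + mu)) ^ 2 = b * b + s * s + 2 * (b * s) by rewrite /b; ring.
    rewrite D2. nra.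
  have G : gam * (d * d * (s * (2 + mu)) ^ 2) = mu ^ 2 * (s * s) ^ 2.
    rewrite /gam /d. field. lra.
  have : gam * (d * d * D ^ 2) <= mu ^ 2 * (s * s) ^ 2.
    rewrite -G. apply: Rmult_le_compat_l; first lra. apply: Rmult_le_compat_l => //; nra.
  have : mu ^ 2 * (s * s) ^ 2 <= d * d * D ^ 2 - b * b * N ^ 2.
    rewrite N2 D2.
    have -> : d * d * (b * b + s * s - 2 * b * s * c) - b * b * (d * d + s * s - 2 * d * s * c) = (s * s) * (s * s) * mu * ((2 + 3 * mu) - 2 * (1 + mu) * ((1 + 2 * mu) * c)).
      rewrite /b /d. ring.
    have -> : mu ^ 2 * (s * s) ^ 2 = s * s * (s * s) * mu * mu by ring.
    apply: Rmult_le_compat_l; nra.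
  lra.
have [M HM] : exists M, forall a, 0 <= a <= 2 * PI -> Cmod (h (circ z0 s a)) <= M.
  have PI0 := PI_RGT_0.
  have [|M [HM _]] := continuity_ab_maj (fun a => Cmod (h (circ z0 s a))) 0 (2 * PI) ltac:(lra).
    move=> a _. apply/continuity_pt_filterlim.
    apply: (continuity_2d_pt_r (fun t a => Cmod (h (circ z0 t a))) s a).
    apply/continuity_2d_pt_filterlim.
    apply: (continuous_Cmod (fun p : C => h (circ z0 (fst p) (snd p))) (s, a)).
    apply: ccont_circ. apply: (hol_ccont _ _ _ hh). rewrite Cmod_circ Rabs_pos_eq; lra.
  by exists (Cmod (h (circ z0 s M))).
have c0 : 0 < Cmod (h z0) by apply/Cmod_gt_0.
have lower n : Cmod (h z0) ^ 2 <= M ^ 2 * (1 - gam) ^ n.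
  have [a [ar Ha]] : exists a, 0 <= a <= 2 * PI /\ Re ((fun z => 1 - h z * W z ^ n / h z0)%C (circ z0 s a)) <= 0.
    apply: (circle_principle (fun z => 1 - h z * W z ^ n / h z0)%C z0 r' s) => //.
    - apply: (hol_subset (fun z => Cmod (z - z0) < r')) => [z [] //|].
      apply: hol_minus; first exact: hol_const. apply: hol_mult; last exact: hol_const.
      apply: hol_mult; last exact: hol_pow.
      apply: hol_subset hh => z. have := Rmin_l r b. rewrite -/r'. lra.
    - apply: (hol_ccont (fun z => Cmod (z - z0) < r')).
        apply: hol_minus; first exact: hol_const. apply: hol_mult; last exact: hol_const.
        apply: hol_mult; last exact: hol_pow.
        apply: hol_subset hh => z. have := Rmin_l r b. rewrite -/r'. lra.
      have -> : (z0 - z0 = 0)%C by ring. rewrite Cmod_0. lra.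
    - rewrite W0. have -> : (1 ^ n = 1)%C by elim: (n) => //= m ->; ring.
      have -> : (1 - h z0 * 1 / h z0 = 0)%C by field. rewrite /=; lra.
  have big : 1 <= Cmod (h (circ z0 s a) * W (circ z0 s a) ^ n / h z0).
    set q := (_ / _)%C in Ha *.
    have := re_le_Cmod q. have := Rle_abs (Re q). move: Ha; cfold; lra.
  rewrite Cmod_div // Cmod_mult Cmod_pow in big.
  have {}big : Cmod (h z0) <= Cmod (h (circ z0 s a)) * Cmod (W (circ z0 s a)) ^ n.
    have := proj2 (Rle_div_r _ _ _ c0) big. lra.
  case: (Rle_lt_dec (Re ((cos a, sin a) * Cconj e)%C) kappa) => [/Wsmall Wa|/arc E]; last first.
    rewrite E Cmod_0 Rmult_0_l in big. lra.
  apply: Rle_trans (_ : (Cmod (h (circ z0 s a)) * Cmod (W (circ z0 s a)) ^ n) ^ 2 <= _).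
    apply: pow_incr; lra.
  rewrite Rpow_mult_distr -pow_mult Nat.mul_comm pow_mult.
  apply: Rmult_le_compat; try (apply: pow_le; try apply: pow_le; exact: Cmod_ge_0).
    apply: pow_incr; split; [exact: Cmod_ge_0|exact: HM].
  apply: pow_incr; split => //. apply: pow_le; exact: Cmod_ge_0.
have gam1 : gam <= 1.
  have mu1 : mu < 1 by rewrite /mu; lra.
  apply/Rle_div_l; last by nra.
  apply: Rmult_lt_0_compat; apply: pow_lt; lra.
have M0 : 0 <= M.
  apply: Rle_trans (Cmod_ge_0 _) (HM 0 _). have := PI_RGT_0; lra.
(* Dividing by [M ^ 2 + 1] keeps the denominator positive even when [M = 0]. *)
have y0 : 0 < Cmod (h z0) ^ 2 / (M ^ 2 + 1) by apply: Rdiv_lt_0_compat; nra.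
have [n Hn] := pow_lt_1_zero (1 - gam) ltac:(rewrite Rabs_pos_eq; lra) _ y0.
have {}Hn := Hn n (Nat.le_refl n).
have t0 : 0 <= (1 - gam) ^ n by apply: pow_le; lra.
rewrite Rabs_pos_eq // in Hn.
move/Rlt_div_r: Hn => /(_ ltac:(nra)) Hn.
have := lower n. nra.
Qed.

Definition cut (h : C -> C) (z : C) : C :=
  match Rle_dec 0 (Im z) with left _ => h z | right _ => 0%C end.

Lemma cut_upper h z : 0 <= Im z -> cut h z = h z.
Proof. by rewrite /cut; case: Rle_dec. Qed.

Lemma cut_lower h z : Im z < 0 -> cut h z = 0%C.
Proof. move=> H; rewrite /cut; case: Rle_dec => // ?; lra. Qed.

Lemma ccont_locally_Cmod (h : C -> C) z e : ccont h z -> 0 < e ->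
  locally z (fun w => Cmod (h w - h z) < e).
Proof.
move=> /ccont_continuous c e0. apply: (c (fun w => Cmod (w - h z) < e)).
have := locally_Cmod_lt (h z) (h z) e. apply.
have -> : (h z - h z = 0)%C by ring. by rewrite Cmod_0.
Qed.

Lemma locally_Im_pos (z : C) : 0 < Im z -> locally z (fun w : C => 0 < Im w).
Proof.
move=> H. have c : continuous (fun w : C => Im w) z by exact: continuous_snd.
apply: (c (fun t => 0 < t)). exact: open_gt.
Qed.

Lemma locally_Im_neg (z : C) : Im z < 0 -> locally z (fun w : C => Im w < 0).
Proof.
move=> H. have c : continuous (fun w : C => Im w) z by exact: continuous_snd.
apply: (c (fun t => t < 0)). exact: open_lt.
Qed.

Lemma ccont_ext_loc f g z : locally z (fun w => f w = g w) -> ccont f z -> ccont g z.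
Proof.
move=> L [a b]; split; [apply: continuous_ext_loc a|apply: continuous_ext_loc b]; by apply: filter_imp L => w ->.
Qed.

Lemma ccont_cut h z : ccont h z -> (Im z = 0 -> h z = 0%C) -> ccont (cut h) z.
Proof.
move=> c z0. case: (Rtotal_order (Im z) 0) => [neg|[zero|pos]].
- apply: (ccont_ext_loc (fun _ => 0%C)); last exact: ccont_const.
  by apply: filter_imp (locally_Im_neg _ neg) => w /cut_lower ->.
- apply: ccont_Cmod => e e0. apply: filter_imp (ccont_locally_Cmod _ _ _ c e0) => w.
  rewrite (cut_upper h z) ?z0 ?Cminus_0_r //; last lra.
  rewrite /cut. by case: Rle_dec => // _ _; rewrite Cmod_0.
- apply: (ccont_ext_loc h) => //.
  apply: filter_imp (locally_Im_pos _ pos) => w wp. rewrite cut_upper //; lra.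
Qed.

Lemma is_derive_cut (f : R -> R) : f 0 = 0 -> is_derive f 0 0 ->
  is_derive (fun s => match Rle_dec 0 s with left _ => f s | right _ => 0 end) 0 0.
Proof.
move=> f0 /is_derive_Reals D. apply/is_derive_Reals => e e0.
have [d Hd] := D e e0. exists d => t t0 td. have := Hd t t0 td.
rewrite Rplus_0_l f0. case: (Rle_dec 0 0) => [_|]; last lra.
case: (Rle_dec 0 t) => [? //|? _].
have -> : (0 - 0) / t - 0 = 0 by field. by rewrite Rabs_R0.
Qed.

(* Vanishing on the real axis forces the derivative to vanish there too, so the extension of [h] by
   zero across the axis is still C^1. *)
Lemma hol_cut (h : C -> C) (Om : C -> Prop) : (forall z, Om z -> locally z Om) ->
  (forall z, Om z -> Im z = 0 -> h z = 0%C) -> hol Om h -> hol Om (cut h).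
Proof.
move=> op real0 [h' H]; exists (cut h') => z Oz.
have [c [[[a1 a2] [b1 b2]] c']] := H z Oz.
have h'0 : Im z = 0 -> h' z = 0%C.
  move=> Iz. have L := op z Oz. rewrite -{1}(C_eta z) in L.
  have Lx : locally (Re z) (fun t => h (t, Im z) = 0%C).
    have := proj2 (locally_2d_locally (fun x y => Om (x, y)) (Re z) (Im z)).
    move=> /(_ ltac:(apply: filter_imp L => -[] //)) /locally_2d_1d_const_y.
    apply: filter_imp => t Ot. by rewrite real0.
  have E1 : Re (h' z) = 0.
    rewrite -(is_derive_unique _ _ _ a1). apply: is_derive_unique.
    apply: (is_derive_ext_loc (fun _ => Re 0%C)); last exact: is_derive_const.
    by apply: filter_imp Lx => t ->.
  have E2 : Im (h' z) = 0.
    rewrite -(is_derive_unique _ _ _ a2). apply: is_derive_unique.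
    apply: (is_derive_ext_loc (fun _ => Im 0%C)); last exact: is_derive_const.
    by apply: filter_imp Lx => t ->.
  by rewrite -(C_eta (h' z)) E1 E2.
split; first by apply: ccont_cut => // ?; apply: real0.
split; last exact: ccont_cut.
case: (Rtotal_order (Im z) 0) => [neg|[zero|pos]].
- rewrite cut_lower //.
  split.
    split.
      apply: (is_derive_ext (fun _ => Re 0%C)); last exact: is_derive_const.
      move=> t; by rewrite cut_lower.
    apply: (is_derive_ext (fun _ => Im 0%C)); last exact: is_derive_const.
    move=> t; by rewrite cut_lower.
  rewrite Cmult_0_r.
  have L : locally (Im z) (fun t => t < 0) by exact: open_lt.
  split.
    apply: (is_derive_ext_loc (fun _ => Re 0%C)); last exact: is_derive_const.
    apply: filter_imp L => t tn. by rewrite cut_lower.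
  apply: (is_derive_ext_loc (fun _ => Im 0%C)); last exact: is_derive_const.
  apply: filter_imp L => t tn. by rewrite cut_lower.
- rewrite cut_upper; last lra.
  split.
    by split; [apply: is_derive_ext a1|apply: is_derive_ext a2] => t; rewrite cut_upper //=; lra.
  have hz : h (Re z, 0) = 0%C by rewrite -[X in (_, X)]zero C_eta; apply: real0.
  move: b1 b2. rewrite h'0 // Cmult_0_r zero => b1 b2.
  split.
    apply: (is_derive_ext (fun s => match Rle_dec 0 s with left _ => Re (h (Re z, s)) | right _ => 0 end)).
      by move=> t; rewrite /cut /=; case: Rle_dec.
    apply: is_derive_cut => //. by rewrite hz.
  apply: (is_derive_ext (fun s => match Rle_dec 0 s with left _ => Im (h (Re z, s)) | right _ => 0 end)).
    by move=> t; rewrite /cut /=; case: Rle_dec.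
  apply: is_derive_cut => //. by rewrite hz.
- rewrite cut_upper; last lra.
  split.
    by split; [apply: is_derive_ext a1|apply: is_derive_ext a2] => t; rewrite cut_upper //=; lra.
  have L : locally (Im z) (fun t => 0 < t) by exact: open_gt.
  split; [apply: is_derive_ext_loc b1|apply: is_derive_ext_loc b2];
    apply: filter_imp L => t tp; rewrite cut_upper //=; lra.
Qed.

Lemma locally_unit_disc (z : C) : Cmod z < 1 -> locally z (fun w : C => Cmod w < 1).
Proof.
move=> H. have := locally_Cmod_lt 0%C z 1. rewrite Cminus_0_r => /(_ H).
by apply: filter_imp => w; rewrite Cminus_0_r.
Qed.

Lemma in_unit_disc (z w : C) r : Cmod z + r <= 1 -> Cmod (w - z) < r -> Cmod w < 1.
Proof. move=> zr wz. have := Cmod_triangle z (w - z). have -> : (z + (w - z) = w)%C by ring. lra. Qed.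

(** [cut h] vanishes below the axis, and the circle of radius [1 / 2] about [z] dips below it
    because [Im z < 1 / 2]. *)
Lemma identity_upper_half (h : C -> C) :
  hol (fun z => Cmod z < 1) h -> (forall z, Cmod z < 1 -> Im z = 0 -> h z = 0%C) ->
  forall z, Cmod z < / 2 -> 0 <= Im z -> h z = 0%C.
Proof.
move=> hh real0 z z2 Iz.
have hk : hol (fun z => Cmod z < 1) (cut h) by apply: hol_cut => //; exact: locally_unit_disc.
have Iz' : Im z <= Cmod z.
  have := Rmax_Cmod z. have := Rmax_r (Rabs (fst z)) (Rabs (snd z)). have := Rle_abs (snd z). rewrite /Im. lra.
rewrite -(cut_upper h) //.
pose s := / 2.
apply: (zero_from_arc (cut h) z (- Ci)%C (1 - Cmod z) s (Im z / s)).
- apply: hol_subset hk => w. apply: in_unit_disc; lra.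
- rewrite /s; lra.
- by rewrite Cmod_opp Cmod_Ci.
- rewrite /s; split; first by apply: Rle_mult_inv_pos; lra. apply/Rlt_div_l; lra.
- move=> a. have -> : Re ((cos a, sin a) * Cconj (- Ci))%C = - sin a by cfold; ring.
  move/Rlt_div_l => /(_ ltac:(rewrite /s; lra)) H. apply: cut_lower. rewrite /= ; lra.
Qed.

(** A circle about [z] reaches back into the disc where [h] vanishes, along an arc centred in the
    direction of [- z]. *)
Lemma identity_step (h : C -> C) a : / 2 <= a < 1 ->
  hol (fun z => Cmod z < 1) h -> (forall z, Cmod z < a -> h z = 0%C) ->
  forall z, Cmod z < (1 + a) / 2 -> h z = 0%C.
Proof.
move=> ar hh ha z zr. case: (Rlt_le_dec (Cmod z) a) => [|za]; first exact: ha.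
have z0 : z <> 0%C by apply/Cmod_gt_0; lra.
set m := Cmod z in zr za *.
have [s sE] : exists s, s = (1 - a) / 2 by exists ((1 - a) / 2).
have s0 : 0 < s by lra.
have m1 : Cmod (/ RtoC m) = / m.
  rewrite Cmod_inv; last by move=> /RtoC_inj; lra. rewrite Cmod_R Rabs_pos_eq //; lra.
have ms : 0 < 2 * m * s by nra.
(* The value of [kappa] is the law of cosines: [m^2 + s^2 - 2 m s c < a^2] exactly when
   [c > kappa]. *)
apply: (zero_from_arc h z (- z * / RtoC m)%C (1 - m) s ((m * m + s * s - a * a) / (2 * m * s))).
- apply: hol_subset hh => w. apply: in_unit_disc; rewrite -/m; lra.
- lra.
- rewrite Cmod_mult Cmod_opp m1 -/m. field; lra.
- split; first by apply: Rle_mult_inv_pos => //; nra. apply/Rlt_div_l => //; nra.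
- move=> t. have -> : Re ((cos t, sin t) * Cconj (- z * / RtoC m))%C = - (cos t * fst z + sin t * snd z) / m.
    cfold. field. lra.
  move/Rlt_div_l => /(_ ms).
  have -> : - (cos t * fst z + sin t * snd z) / m * (2 * m * s) = - (2 * s * (cos t * fst z + sin t * snd z)) by field; lra.
  move=> H. apply: ha.
  apply: Rsqr_incrst_0; [|exact: Cmod_ge_0|lra].
  have E : Rsqr (Cmod (circ z s t)) = Cmod (circ z s t) ^ 2 by rewrite /Rsqr; ring.
  rewrite E Cmod2_alt /Rsqr.
  have M : m * m = fst z ^ 2 + snd z ^ 2 by rewrite -(Cmod2_alt z) /m; ring.
  have cs : cos t * cos t + sin t * sin t = 1 by have := sin2_cos2 t; rewrite /Rsqr; lra.
  have : Re (circ z s t) ^ 2 + Im (circ z s t) ^ 2 = m * m + s * s * (cos t * cos t + sin t * sin t) + 2 * s * (cos t * fst z + sin t * snd z).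
    rewrite M. cfold. ring.
  rewrite cs. lra.
Qed.

(** Reflection settles the lower half of the disc of radius [1 / 2]; then [identity_step] halves the
    distance of the radius to 1 repeatedly. *)
Lemma identity_principle (h : C -> C) :
  hol (fun z => Cmod z < 1) h -> (forall z, Cmod z < 1 -> Im z = 0 -> h z = 0%C) ->
  forall z, Cmod z < 1 -> h z = 0%C.
Proof.
move=> hh real0.
have base z : Cmod z < / 2 -> h z = 0%C.
  move=> z2. case: (Rle_lt_dec 0 (Im z)) => Iz; first exact: identity_upper_half.
  have hr : hol (fun z => Cmod z < 1) (reflect h).
    apply: hol_reflect hh => w. by rewrite Cmod_conj.
  have C00 : Cconj 0 = 0%C by apply: injective_projections => /=; lra.
  have := identity_upper_half (reflect h) hr _ (Cconj z).
  rewrite Cmod_conj im_conj /reflect Cconj_conj => /(_ _ z2 ltac:(lra)) E.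
  rewrite -(Cconj_conj (h z)) E ?C00 // => w w1 Iw.
  rewrite real0 ?C00 ?Cmod_conj ?im_conj //; lra.
have iter n : forall z, Cmod z < 1 - (/ 2) ^ (S n) -> h z = 0%C.
  elim: n => [|n IH] z.
    rewrite pow_1 => ?; apply: base; lra.
  have p0 : 0 < (/ 2) ^ S n by apply: pow_lt; lra.
  have p1 : (/ 2) ^ S n <= / 2.
    have : (/ 2) ^ n <= 1 by rewrite -(pow1 n); apply: pow_incr; lra. rewrite /=; lra.
  move=> zn. apply: (identity_step h (1 - (/ 2) ^ S n)) => //; first lra.
  move: zn => /=. lra.
move=> z z1.
have [n Hn] := pow_lt_1_zero (/ 2) ltac:(rewrite Rabs_pos_eq; lra) (1 - Cmod z) ltac:(lra).
apply: (iter n). have := Hn (S n) ltac:(lia). rewrite Rabs_pos_eq; last by apply: pow_le; lra. lra.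
Qed.

(** * Octonions and slice functions *)

Definition cdot (a b : C) : R := fst a * fst b + snd a * snd b.

Definition odot (v w : oct) : R :=
  cdot (fst (fst v)) (fst (fst w)) + cdot (snd (fst v)) (snd (fst w)) +
  (cdot (fst (snd v)) (fst (snd w)) + cdot (snd (snd v)) (snd (snd w))).

(** Conjugation as [2 Re w - w], the real part being the inner product with 1. *)
Definition oct_conj (w : oct) : oct := oct_plus (oct_scal (2 * odot w oct_one) oct_one) (oct_opp w).

Definition mk_oct (x0 x1 x2 x3 x4 x5 x6 x7 : R) : oct := (((x0, x1), (x2, x3)), ((x4, x5), (x6, x7))).

Lemma oct_mk_ind (P : oct -> Prop) :
  (forall x0 x1 x2 x3 x4 x5 x6 x7, P (mk_oct x0 x1 x2 x3 x4 x5 x6 x7)) -> forall v, P v.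
Proof. by move=> H [[[? ?] [? ?]] [[? ?] [? ?]]]; apply: H. Qed.

Ltac oct_raw := unfold odot, cdot, oct_mult, quat_mult, quat_conj, oct_plus, oct_opp, oct_scal,
  Cminus, Cplus, Cmult, Copp, Cconj, mk_oct; simpl;
  unfold minus, plus, opp, scal, mult; simpl; unfold plus, opp, scal, mult; simpl;
  repeat apply injective_projections; simpl; toR; unfold opp, plus, mult; simpl; ring.

Lemma odotE x0 x1 x2 x3 x4 x5 x6 x7 y0 y1 y2 y3 y4 y5 y6 y7 : odot (mk_oct x0 x1 x2 x3 x4 x5 x6 x7) (mk_oct y0 y1 y2 y3 y4 y5 y6 y7) =
  x0 * y0 + x1 * y1 + x2 * y2 + x3 * y3 + x4 * y4 + x5 * y5 + x6 * y6 + x7 * y7.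
Proof. rewrite /odot /cdot /=. ring. Qed.

Lemma oct_plusE x0 x1 x2 x3 x4 x5 x6 x7 y0 y1 y2 y3 y4 y5 y6 y7 : oct_plus (mk_oct x0 x1 x2 x3 x4 x5 x6 x7) (mk_oct y0 y1 y2 y3 y4 y5 y6 y7) =
  mk_oct (x0 + y0) (x1 + y1) (x2 + y2) (x3 + y3) (x4 + y4) (x5 + y5) (x6 + y6) (x7 + y7).
Proof. by []. Qed.

Lemma oct_scalE r x0 x1 x2 x3 x4 x5 x6 x7 : oct_scal r (mk_oct x0 x1 x2 x3 x4 x5 x6 x7) =
  mk_oct (r * x0) (r * x1) (r * x2) (r * x3) (r * x4) (r * x5) (r * x6) (r * x7).
Proof. by []. Qed.

Lemma oct_oppE x0 x1 x2 x3 x4 x5 x6 x7 : oct_opp (mk_oct x0 x1 x2 x3 x4 x5 x6 x7) =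
  mk_oct (- x0) (- x1) (- x2) (- x3) (- x4) (- x5) (- x6) (- x7).
Proof. by []. Qed.

Lemma oct_oneE : oct_one = mk_oct 1 0 0 0 0 0 0 0.
Proof. by []. Qed.

Lemma oct_zeroE : oct_zero = mk_oct 0 0 0 0 0 0 0 0.
Proof. by []. Qed.

(** Once the product is in coordinates, [oct_ring] reduces octonion identities to real polynomial
    identities. *)
Lemma oct_multE x0 x1 x2 x3 x4 x5 x6 x7 y0 y1 y2 y3 y4 y5 y6 y7 : oct_mult (mk_oct x0 x1 x2 x3 x4 x5 x6 x7) (mk_oct y0 y1 y2 y3 y4 y5 y6 y7) =
  mk_oct
    (x0 * y0 - x1 * y1 - x2 * y2 - x3 * y3 - x4 * y4 - x5 * y5 - x6 * y6 - x7 * y7)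
    (x0 * y1 + x1 * y0 + x2 * y3 - x3 * y2 + x4 * y5 - x5 * y4 - x6 * y7 + x7 * y6)
    (x0 * y2 - x1 * y3 + x2 * y0 + x3 * y1 + x4 * y6 + x5 * y7 - x6 * y4 - x7 * y5)
    (x0 * y3 + x1 * y2 - x2 * y1 + x3 * y0 + x4 * y7 - x5 * y6 + x6 * y5 - x7 * y4)
    (x0 * y4 - x1 * y5 - x2 * y6 - x3 * y7 + x4 * y0 + x5 * y1 + x6 * y2 + x7 * y3)
    (x0 * y5 + x1 * y4 - x2 * y7 + x3 * y6 - x4 * y1 + x5 * y0 - x6 * y3 + x7 * y2)
    (x0 * y6 + x1 * y7 + x2 * y4 - x3 * y5 - x4 * y2 + x5 * y3 + x6 * y0 - x7 * y1)
    (x0 * y7 - x1 * y6 + x2 * y5 + x3 * y4 - x4 * y3 - x5 * y2 + x6 * y1 + x7 * y0).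
Proof. oct_raw. Qed.

Ltac oct_cases := repeat match goal with v : oct |- _ => induction v using oct_mk_ind end.

Ltac oct_simp := unfold oct_conj, slice_point;
  rewrite ?oct_oneE ?oct_zeroE ?(oct_multE, oct_plusE, oct_scalE, oct_oppE, odotE).

Ltac oct_ring := intros; oct_cases; oct_simp; first [ring | f_equal; ring].

Lemma odot_plus_l u v w : odot (oct_plus u v) w = odot u w + odot v w.
Proof. oct_ring. Qed.

Lemma odot_scal_l r v w : odot (oct_scal r v) w = r * odot v w.
Proof. oct_ring. Qed.

Lemma odot_opp_l v w : odot (oct_opp v) w = - odot v w.
Proof. oct_ring. Qed.

Lemma odot_sym v w : odot v w = odot w v.
Proof. oct_ring. Qed.

Lemma odot_ge0 v : 0 <= odot v v.
Proof. oct_cases; oct_simp. nra. Qed.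

(** Degen's eight-square identity. *)
Lemma odot_mult_mult v w : odot (oct_mult v w) (oct_mult v w) = odot v v * odot w w.
Proof. oct_ring. Qed.

Lemma odot_mult_conj_one v w : odot (oct_mult v (oct_conj w)) oct_one = odot v w.
Proof. oct_ring. Qed.

(** Any two octonions generate an associative subalgebra, so the bracketing is harmless here. *)
Lemma oct_mult_conj_mult v w : oct_mult (oct_mult v (oct_conj w)) w = oct_scal (odot w w) v.
Proof. oct_ring. Qed.

Lemma odot_conj w : odot (oct_conj w) (oct_conj w) = odot w w.
Proof. oct_ring. Qed.

Lemma oct_mult_one_r v : oct_mult v oct_one = v.
Proof. oct_ring. Qed.

Lemma oct_mult_scal_l r v w : oct_mult (oct_scal r v) w = oct_scal r (oct_mult v w).
Proof. oct_ring. Qed.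

Lemma oct_square v : oct_mult v v =
  oct_plus (oct_scal (2 * odot v oct_one) v) (oct_scal (- odot v v) oct_one).
Proof. oct_ring. Qed.

(** Left alternativity [v (v w) = v^2 w], with the quadratic equation of [v] substituted. *)
Lemma oct_mult_mult_l v w : oct_mult v (oct_mult v w) =
  oct_plus (oct_scal (2 * odot v oct_one) (oct_mult v w)) (oct_scal (- odot v v) w).
Proof. oct_ring. Qed.

(** The adjoint of left multiplication by [v] is left multiplication by the conjugate
    [2 Re v - v]. *)
Lemma odot_mult_adjoint v c w :
  odot c (oct_mult v w) = 2 * odot v oct_one * odot c w - odot (oct_mult v c) w.
Proof. oct_ring. Qed.

Lemma odot_eq0 v : odot v v = 0 -> v = oct_zero.
Proof.
move: v; refine (oct_mk_ind _ _) => x0 x1 x2 x3 x4 x5 x6 x7. rewrite odotE oct_zeroE => E.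
have sq := Rle_0_sqr. rewrite /Rsqr in sq.
have := sq x0; have := sq x1; have := sq x2; have := sq x3.
have := sq x4; have := sq x5; have := sq x6; have := sq x7.
move=> *. f_equal; apply: Rsqr_0_uniq; rewrite /Rsqr; lra.
Qed.

Lemma odot_ext v w : (forall c, odot c v = odot c w) -> v = w.
Proof.
move=> H.
have E : oct_plus v (oct_opp w) = oct_zero.
  apply: odot_eq0. set d := oct_plus v _. rewrite /d odot_plus_l odot_opp_l !(odot_sym _ d) H. ring.
have -> : v = oct_plus (oct_plus v (oct_opp w)) w by oct_ring.
rewrite E. oct_ring.
Qed.

Lemma oct_normE v : oct_norm v = sqrt (odot v v).
Proof.
have sq (a b : R) : 0 <= a -> 0 <= b -> sqrt (sqrt a ^ 2 + sqrt b ^ 2) = sqrt (a + b).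
  move=> a0 b0. by rewrite !pow2_sqrt.
have cn (z : C) : @norm R_AbsRing C_R_NormedModule z = sqrt (cdot z z).
  rewrite -[LHS]/(sqrt (Rabs (fst z) ^ 2 + Rabs (snd z) ^ 2)) !pow2_abs. f_equal. rewrite /cdot. ring.
have c0 (z : C) : 0 <= cdot z z by rewrite /cdot; nra.
have qn (q : quat) : @norm R_AbsRing quat_NormedModule q = sqrt (cdot (fst q) (fst q) + cdot (snd q) (snd q)).
  rewrite -[LHS]/(sqrt (@norm R_AbsRing C_R_NormedModule (fst q) ^ 2 + @norm R_AbsRing C_R_NormedModule (snd q) ^ 2)).
  by rewrite !cn sq.
rewrite -[LHS]/(sqrt (@norm R_AbsRing quat_NormedModule (fst v) ^ 2 + @norm R_AbsRing quat_NormedModule (snd v) ^ 2)).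
by rewrite !qn sq //; apply: Rplus_le_le_0_compat.
Qed.

(** Let [r = Re J], [n = |J|^2]. Pairing the quadratic equation of [J] with 1 and with [J] gives
    [2 r^2 - n = -1] and [r n = - r]; a nonzero [r] would force [n = -1]. *)
Lemma imag_unit_iff J : imag_unit J <-> odot J oct_one = 0 /\ odot J J = 1.
Proof.
rewrite /imag_unit oct_square; split; last first.
  move=> [-> ->]. by oct_ring.
move=> E.
have H c := f_equal (odot c) E.
have J1 : 2 * odot J oct_one ^ 2 - odot J J = -1.
  have := H oct_one. rewrite !(odot_sym oct_one) odot_plus_l !odot_scal_l odot_opp_l.
  have -> : odot oct_one oct_one = 1 by oct_ring. lra.
have J2 : odot J oct_one * odot J J = - odot J oct_one.
  have := H J. rewrite !(odot_sym J) odot_plus_l !odot_scal_l odot_opp_l (odot_sym oct_one). lra.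
case: (Req_dec (odot J oct_one) 0) => [Z|NZ].
  rewrite Z in J1 *. lra.
have K : odot J J = -1 by nra.
have := odot_ge0 J. lra.
Qed.

Lemma odot_slice_point_one J x y : imag_unit J -> odot oct_one (slice_point J x y) = x.
Proof.
move=> /imag_unit_iff [J0 _]. rewrite odot_sym /slice_point odot_plus_l !odot_scal_l J0.
have -> : odot oct_one oct_one = 1 by oct_ring. ring.
Qed.

Lemma odot_slice_point_unit J x y : imag_unit J -> odot J (slice_point J x y) = y.
Proof.
move=> /imag_unit_iff [J0 J1]. rewrite odot_sym /slice_point odot_plus_l !odot_scal_l J1 (odot_sym oct_one) J0. ring.
Qed.

Lemma odot_slice_point c J x y : odot c (slice_point J x y) = x * odot c oct_one + y * odot c J.
Proof. oct_ring. Qed.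

Lemma odot_slice_slice J x y : imag_unit J ->
  odot (slice_point J x y) (slice_point J x y) = x ^ 2 + y ^ 2.
Proof.
move=> iJ. rewrite odot_slice_point (odot_sym _ oct_one) (odot_sym _ J).
rewrite odot_slice_point_one // odot_slice_point_unit //. ring.
Qed.

Lemma oct_norm_slice_point J x y : imag_unit J -> oct_norm (slice_point J x y) = Cmod (x, y).
Proof. by move=> iJ; rewrite oct_normE odot_slice_slice. Qed.

(** * Scalar components of a slice regular function *)

Lemma is_derive_fst {U V : NormedModule R_AbsRing} (F : R -> U * V) (x : R) (d : U * V) :
  is_derive F x d -> is_derive (fun t => fst (F t)) x (fst d).
Proof.
move=> D.
exact: (filterdiff_comp' F (fun p : U * V => fst p) x _ _ D (filterdiff_linear _ is_linear_fst)).
Qed.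

Lemma is_derive_snd {U V : NormedModule R_AbsRing} (F : R -> U * V) (x : R) (d : U * V) :
  is_derive F x d -> is_derive (fun t => snd (F t)) x (snd d).
Proof.
move=> D.
exact: (filterdiff_comp' F (fun p : U * V => snd p) x _ _ D (filterdiff_linear _ is_linear_snd)).
Qed.

Lemma is_derive_odot c (F : R -> oct) x d : @is_derive R_AbsRing oct_NormedModule F x d ->
  is_derive (fun t => odot c (F t)) x (odot c d).
Proof.
move=> D.
have lin (a : R) (f : R -> R) l : is_derive f x l -> is_derive (fun t => a * f t) x (a * l).
  exact: is_derive_scal.
have dc a (f : R -> C) l : @is_derive R_AbsRing C_R_NormedModule f x l ->
    is_derive (fun t => cdot a (f t)) x (cdot a l).
  move=> Df. apply: is_derive_Rplus; apply: lin; [exact: is_derive_fst Df|exact: is_derive_snd Df].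
have dq a (f : R -> quat) l : @is_derive R_AbsRing quat_NormedModule f x l ->
    is_derive (fun t => cdot (fst a) (fst (f t)) + cdot (snd a) (snd (f t))) x
      (cdot (fst a) (fst l) + cdot (snd a) (snd l)).
  move=> Df. apply: is_derive_Rplus; apply: dc; [exact: is_derive_fst Df|exact: is_derive_snd Df].
apply: is_derive_Rplus; apply: dq; [exact: is_derive_fst D|exact: is_derive_snd D].
Qed.

Lemma continuous_odot {T : UniformSpace} c (F : T -> oct) (x : T) : @continuous T oct_NormedModule F x ->
  continuous (fun t => odot c (F t)) x.
Proof.
move=> D.
have cfst (U V : UniformSpace) (f : T -> U * V) : continuous f x -> continuous (fun t => fst (f t)) x.
  move=> cf. apply: (continuous_comp f fst) => //. case: (f x) => a b. exact: continuous_fst.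
have csnd (U V : UniformSpace) (f : T -> U * V) : continuous f x -> continuous (fun t => snd (f t)) x.
  move=> cf. apply: (continuous_comp f snd) => //. case: (f x) => a b. exact: continuous_snd.
have lin (a : R) (f : T -> R) : continuous f x -> continuous (fun t => a * f t) x.
  move=> cf. apply: continuous_mult => //. exact: continuous_const.
have dc a (f : T -> C) : @continuous T C_UniformSpace f x -> continuous (fun t => cdot a (f t)) x.
  move=> Df. apply: continuous_plus; apply: lin; [exact: cfst Df|exact: csnd Df].
have dq a (f : T -> quat) : @continuous T quat_NormedModule f x ->
    continuous (fun t => cdot (fst a) (fst (f t)) + cdot (snd a) (snd (f t))) x.
  move=> Df. apply: continuous_plus; apply: dc; [exact: cfst Df|exact: csnd Df].
apply: continuous_plus; apply: dq; [exact: cfst D|exact: csnd D].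
Qed.

(* The slice [f_J] composed with the functional [<c, .>], completed to a complex-valued function;
   left multiplication by [J] on octonions becomes multiplication by [Ci]. *)
Definition slice_part (f : oct -> oct) (J c : oct) (z : C) : C :=
  (odot c (f (slice_point J (Re z) (Im z))), odot (oct_mult J c) (f (slice_point J (Re z) (Im z)))).

(** Left multiplication by [J] is skew-adjoint and squares to -1, so pairing the slice equation with
    [c] and with [J c] gives the two Cauchy-Riemann equations. *)
Lemma cauchy_riemann_odot J c fx fy : imag_unit J ->
  oct_scal (1 / 2) (oct_plus fx (oct_mult J fy)) = oct_zero ->
  odot c fy = - odot (oct_mult J c) fx /\ odot (oct_mult J c) fy = odot c fx.
Proof.
move=> iJ; have [J0 J1] := proj1 (imag_unit_iff _) iJ => E.
have H v : odot v fx + odot v (oct_mult J fy) = 0.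
  have := f_equal (odot v) E. rewrite !(odot_sym v) odot_scal_l odot_plus_l.
  have -> : odot oct_zero v = 0 by oct_ring. lra.
have A v w : odot v (oct_mult J w) = - odot (oct_mult J v) w by rewrite odot_mult_adjoint J0; ring.
have H1 := H c. have H2 := H (oct_mult J c). rewrite !A in H1 H2.
rewrite oct_mult_mult_l J0 J1 odot_plus_l !odot_scal_l in H2. lra.
Qed.

Lemma slice_part_has_cderiv f J c x y fx fy : imag_unit J ->
  is_partial_x f J x y fx -> is_partial_y f J x y fy ->
  oct_scal (1 / 2) (oct_plus fx (oct_mult J fy)) = oct_zero ->
  has_cderiv (slice_part f J c) (x, y) (odot c fx, odot (oct_mult J c) fx).
Proof.
move=> iJ dx dy cr. have [E1 E2] := cauchy_riemann_odot J c fx fy iJ cr.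
split; split.
- exact: (is_derive_odot c _ _ _ dx).
- exact: (is_derive_odot (oct_mult J c) _ _ _ dx).
- apply: (is_derive_eq _ _ (odot c fy)); last by rewrite E1; cfold; ring.
  exact: (is_derive_odot c _ _ _ dy).
- apply: (is_derive_eq _ _ (odot (oct_mult J c) fy)); last by rewrite E2; cfold; ring.
  exact: (is_derive_odot (oct_mult J c) _ _ _ dy).
Qed.

Lemma hol_intro (Om : C -> Prop) (h h' : C -> C) : (forall z, Om z -> locally z Om) ->
  (forall z, Om z -> has_cderiv h z (h' z)) -> (forall z, Om z -> ccont h' z) -> hol Om h.
Proof.
move=> op d c; exists h' => z Oz; split; last by split; [exact: d|exact: c].
have [d1 d2] := has_cderiv_cdiff h h' z (filter_imp _ _ d (op z Oz)) (c z Oz).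
have cc (k : C -> R) : continuity_2d_pt (fun x y => k (x, y)) (Re z) (Im z) -> continuous k z.
  move/continuity_2d_pt_filterlim => H. rewrite -(C_eta z).
  by apply: continuous_ext H => -[].
split; [apply: (cc (fun w => Re (h w)))|apply: (cc (fun w => Im (h w)))]; apply: differentiable_continuity_pt; eexists; eexists; eassumption.
Qed.

Lemma slice_part_hol f J c : slice_regular (oct_ball 1) f -> imag_unit J ->
  hol (fun z => Cmod z < 1) (slice_part f J c).
Proof.
move=> sr iJ. have [fx [fy H]] := sr J iJ.
have inb (z : C) : Cmod z < 1 -> oct_ball 1 (slice_point J (Re z) (Im z)).
  by move=> z1; rewrite /oct_ball oct_norm_slice_point // C_eta.
apply: (hol_intro _ _ (fun z => (odot c (fx (Re z) (Im z)), odot (oct_mult J c) (fx (Re z) (Im z))))).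
- exact: locally_unit_disc.
- move=> z /inb Bz. have [dx [dy [_ [_ cr]]]] := H _ _ Bz.
  have := slice_part_has_cderiv f J c _ _ _ _ iJ dx dy cr. by rewrite C_eta.
- move=> z /inb Bz. have [_ [_ [cx _]]] := H _ _ Bz.
  rewrite -/(fst z) -/(snd z) in cx.
  have e : (Re z, Im z) = z by exact: C_eta.
  rewrite e in cx.
  split; [exact: (continuous_odot c _ _ cx)|exact: (continuous_odot (oct_mult J c) _ _ cx)].
Qed.

Lemma slice_point_0 J : slice_point J 0 0 = oct_zero.
Proof. oct_ring. Qed.

Lemma slice_point_real J K x : slice_point J x 0 = slice_point K x 0.
Proof. oct_ring. Qed.

(** For [c = oct_one] the two functionals pair with 1 and [I], an orthonormal basis of the slice. *)
Lemma in_slice_eq f I z : imag_unit I -> in_slice I (f (slice_point I (Re z) (Im z))) ->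
  f (slice_point I (Re z) (Im z)) =
  slice_point I (Re (slice_part f I oct_one z)) (Im (slice_part f I oct_one z)).
Proof.
move=> iI [x [y E]]. rewrite /slice_part /= E oct_mult_one_r.
by rewrite odot_slice_point_one // odot_slice_point_unit.
Qed.

Lemma slice_part_normalized f I : slice_regular (oct_ball 1) f -> imag_unit I ->
  f oct_zero = oct_zero -> is_slice_derivative f oct_zero oct_one ->
  normalized (slice_part f I oct_one).
Proof.
move=> sr iI f0 d1; split; first exact: slice_part_hol.
split.
  rewrite /slice_part /= slice_point_0 f0. apply: injective_projections; simpl; oct_ring.
have [fx [fy H]] := sr I iI.
have B0 : oct_ball 1 (slice_point I 0 0).
  rewrite /oct_ball oct_norm_slice_point //. rewrite -/(RtoC 0) Cmod_0. lra.
have [px [py [_ [_ cr]]]] := H 0 0 B0.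
have [dx [dy [qx [qy E]]]] := d1 I 0 0 iI (eq_sym (slice_point_0 I)).
have Ex : dx = fx 0 0.
  apply: odot_ext => c.
  by rewrite -(is_derive_unique _ _ _ (is_derive_odot c _ _ _ px)) -(is_derive_unique _ _ _ (is_derive_odot c _ _ _ qx)).
have Ey : dy = fy 0 0.
  apply: odot_ext => c.
  by rewrite -(is_derive_unique _ _ _ (is_derive_odot c _ _ _ py)) -(is_derive_unique _ _ _ (is_derive_odot c _ _ _ qy)).
have fx1 : fx 0 0 = oct_one.
  rewrite Ex Ey in E. apply: odot_ext => c.
  have := f_equal (odot c) E. have := f_equal (odot c) cr.
  rewrite !(odot_sym c) !odot_scal_l !odot_plus_l odot_opp_l.
  have -> : odot oct_zero c = 0 by oct_ring. lra.
have := slice_part_has_cderiv f I oct_one _ _ _ _ iI px py cr.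
rewrite fx1 oct_mult_one_r.
have [-> _] := proj1 (imag_unit_iff I) iI.
by have -> : odot oct_one oct_one = 1 by oct_ring.
Qed.

Lemma slice_part_injective f I : imag_unit I ->
  (forall w1 w2 : oct, oct_ball 1 w1 -> in_slice I w1 -> oct_ball 1 w2 -> in_slice I w2 ->
    f w1 = f w2 -> w1 = w2) ->
  (forall w : oct, oct_ball 1 w -> in_slice I w -> in_slice I (f w)) ->
  injective_on (fun z => Cmod z < 1) (slice_part f I oct_one).
Proof.
move=> iI inj pres z w z1 w1 E.
have inb (u : C) : Cmod u < 1 -> oct_ball 1 (slice_point I (Re u) (Im u)).
  by move=> u1; rewrite /oct_ball oct_norm_slice_point // C_eta.
have ins (u : C) : in_slice I (slice_point I (Re u) (Im u)) by eexists; eexists.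
have Fz := in_slice_eq f I z iI (pres _ (inb z z1) (ins z)).
have Fw := in_slice_eq f I w iI (pres _ (inb w w1) (ins w)).
rewrite E -Fw in Fz.
have K := inj _ _ (inb z z1) (ins z) (inb w w1) (ins w) Fz.
rewrite -(C_eta z) -(C_eta w).
have -> : Re z = Re w by rewrite -(odot_slice_point_one I (Re z) (Im z) iI) K odot_slice_point_one.
by have -> : Im z = Im w by rewrite -(odot_slice_point_unit I (Re z) (Im z) iI) K odot_slice_point_unit.
Qed.

(** With [odd_part], the holomorphic extensions of [Re g] and [Im g] from the real axis; [g] is
    [even_part + i odd_part]. *)
Definition even_part (g : C -> C) (z : C) : C := ((g z + reflect g z) / 2)%C.

Definition odd_part (g : C -> C) (z : C) : C := ((g z - reflect g z) / (2 * Ci))%C.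

(** Paired with any [c], both sides are real parts of holomorphic functions of [z]. These agree on
    the real axis, which lies in every slice, so the identity principle applies. *)
Lemma representation_formula f I J z : slice_regular (oct_ball 1) f -> imag_unit I -> imag_unit J ->
  (forall w : oct, oct_ball 1 w -> in_slice I w -> in_slice I (f w)) ->
  Cmod z < 1 ->
  let g := slice_part f I oct_one in
  f (slice_point J (Re z) (Im z)) =
  oct_plus (slice_point I (Re (even_part g z)) (Re (odd_part g z)))
    (oct_mult J (slice_point I (Im (even_part g z)) (Im (odd_part g z)))).
Proof.
move=> sr iI iJ pres z1 g.
apply: odot_ext => c.
pose c1 : C := (odot c oct_one, odot (oct_mult J c) oct_one).
pose c2 : C := (odot c I, odot (oct_mult J c) I).
have i2 : (2 * Ci)%C <> 0%C.
  move=> /(f_equal Im). cfold. lra.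
have t2 : RtoC 2 <> 0%C by move=> /RtoC_inj; lra.
have hg : hol (fun z => Cmod z < 1) g by exact: slice_part_hol.
have hr : hol (fun z => Cmod z < 1) (reflect g).
  apply: hol_reflect hg => w. by rewrite Cmod_conj.
have H0 : forall z, Cmod z < 1 ->
    (slice_part f J c z - (c1 * even_part g z + c2 * odd_part g z) = 0)%C.
  apply: identity_principle.
    apply: hol_minus; first exact: slice_part_hol.
    apply: hol_plus; (apply: hol_mult; first exact: hol_const);
      (apply: hol_mult; last exact: hol_const).
      exact: hol_plus.
    exact: hol_minus.
  move=> w w1 Iw.
  have cw : Cconj w = w by rewrite -[in RHS](C_eta w) Iw /Cconj -/(Re w) -/(Im w) Iw Ropp_0.
  have Ew : even_part g w = RtoC (Re (g w)).
    by rewrite re_alt /even_part /reflect cw.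
  have Ow : odd_part g w = RtoC (Im (g w)).
    by rewrite im_alt /odd_part /reflect cw.
  have wI : oct_ball 1 (slice_point I (Re w) (Im w)) by rewrite /oct_ball oct_norm_slice_point // C_eta.
  have fE : f (slice_point J (Re w) (Im w)) = slice_point I (Re (g w)) (Im (g w)).
    rewrite -in_slice_eq //; last by apply: pres => //; eexists; eexists.
    by rewrite Iw (slice_point_real J I).
  rewrite Ew Ow /slice_part fE !odot_slice_point.
  apply: injective_projections; rewrite /c1 /c2; cfold; ring.
have := f_equal Re (Cminus_eq0 _ _ (H0 z z1)).
rewrite [LHS]/= => ->.
have [J0 _] := proj1 (imag_unit_iff J) iJ.
rewrite (odot_sym c) odot_plus_l !(odot_sym _ c) odot_mult_adjoint J0 !odot_slice_point.
rewrite /c1 /c2. cfold. ring.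
Qed.

(** * Covering the ball of radius [1 / 4] *)

Theorem theorem1p9 :
  forall f : oct -> oct,
  slice_regular (oct_ball 1) f ->
  (exists I : oct,
     imag_unit I /\
     (forall w1 w2 : oct,
        oct_ball 1 w1 -> in_slice I w1 ->
        oct_ball 1 w2 -> in_slice I w2 ->
        f w1 = f w2 -> w1 = w2) /\
     (forall w : oct, oct_ball 1 w -> in_slice I w -> in_slice I (f w))) ->
  f oct_zero = oct_zero ->
  is_slice_derivative f oct_zero oct_one ->
  forall w : oct, oct_ball (1 / 4) w ->
  exists z : oct, oct_ball 1 z /\ f z = w.
Proof.
move=> f sr [I [iI [inj pres]]] f0 d1 w w4.
have [I0 I1] := proj1 (imag_unit_iff I) iI.
pose g := slice_part f I oct_one.
(* [a] is the orthogonal projection of [w] to the slice and [b] the squared distance of [w] from it;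
   [dist] below is Pythagoras. *)
pose a : C := (odot w oct_one, odot w I).
pose b := odot w w - Cmod a ^ 2.
have a2 : Cmod a ^ 2 = odot w oct_one ^ 2 + odot w I ^ 2 by exact: Cmod2_alt.
have dist x y : odot (oct_plus w (oct_opp (slice_point I x y))) (oct_plus w (oct_opp (slice_point I x y))) =
    Cmod ((x, y) - a) ^ 2 + b.
  set s := slice_point I x y. set d := oct_plus w (oct_opp s).
  have dE v : odot d v = odot w v - odot s v by rewrite odot_plus_l odot_opp_l; ring.
  rewrite dE (odot_sym w d) (odot_sym s d) !dE (odot_sym s w) /s odot_slice_slice // odot_slice_point.
  rewrite /b a2 Cmod2_alt /a. cfold. ring.
have b0 : 0 <= b.
  have := dist (fst a) (snd a). have := odot_ge0 (oct_plus w (oct_opp (slice_point I (fst a) (snd a)))).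
  have -> : ((fst a, snd a) - a = 0)%C by apply: injective_projections; cfold; ring.
  rewrite Cmod_0. lra.
have ab : Cmod a ^ 2 + b < / 16.
  have w0 := odot_ge0 w.
  have -> : Cmod a ^ 2 + b = odot w w by rewrite /b; ring.
  move: w4. rewrite /oct_ball oct_normE => w4.
  have := sqrt_sqrt _ w0. have := sqrt_pos (odot w w). nra.
have [z [z1 Ez]] := symmetrization_zero g a b (slice_part_normalized f I sr iI f0 d1)
  (slice_part_injective f I iI inj pres) b0 ab.
have inb J : imag_unit J -> oct_ball 1 (slice_point J (Re z) (Im z)).
  by move=> iJ; rewrite /oct_ball oct_norm_slice_point // C_eta.
suff [J [iJ EJ]] : exists J, imag_unit J /\
    oct_plus (slice_point I (Re (even_part g z)) (Re (odd_part g z)))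
      (oct_mult J (slice_point I (Im (even_part g z)) (Im (odd_part g z)))) = w.
  exists (slice_point J (Re z) (Im z)); split; first exact: inb.
  by rewrite (representation_formula f I J).
have GE : g z = (even_part g z + Ci * odd_part g z)%C.
  rewrite /even_part /odd_part. field. move=> /(f_equal Im) /=; lra.
have RE : reflect g z = (even_part g z - Ci * odd_part g z)%C.
  rewrite /even_part /odd_part. field. move=> /(f_equal Im) /=; lra.
rewrite GE RE in Ez.
(* With [alpha = p + q I] and [beta = r + m I], the real part of the vanishing says
   [|w - alpha| = |beta|], the imaginary part [<w, beta> = <alpha, beta>]. *)
move: (even_part g z) (odd_part g z) Ez => [p r] [q m] Ez /=.
have E1 : Cmod ((p, q) - a) ^ 2 + b = r ^ 2 + m ^ 2.
  have := f_equal Re Ez. rewrite Cmod2_alt. case: (a) => a0 a1'. cfold. lra.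
have E2 : odot w (slice_point I r m) = p * r + q * m.
  have := f_equal Im Ez. rewrite odot_slice_point /a. cfold. lra.
set al := slice_point I p q. set be := slice_point I r m.
set v := oct_plus w (oct_opp al).
have bb : odot be be = r ^ 2 + m ^ 2 by exact: odot_slice_slice.
have vv : odot v v = r ^ 2 + m ^ 2 by rewrite /v /al dist.
have vb : odot v be = 0.
  rewrite /v odot_plus_l odot_opp_l E2 /be odot_slice_point /al !(odot_sym (slice_point _ _ _)).
  rewrite odot_slice_point_one // odot_slice_point_unit //. ring.
have wE : w = oct_plus al v by rewrite /v; oct_ring.
(* If [beta = 0] then [w = alpha], and any imaginary unit serves. *)
case: (Req_dec (r ^ 2 + m ^ 2) 0) => [Z|NZ].
  exists I; split => //. rewrite [RHS]wE. rewrite Z in vv bb.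
  rewrite (odot_eq0 v vv) (odot_eq0 be bb). oct_ring.
(* [J = v beta^-1] is imaginary as [v] is orthogonal to [beta], a unit as [|v| = |beta|], and
   [J beta = v] by alternativity. *)
exists (oct_scal (/ (r ^ 2 + m ^ 2)) (oct_mult v (oct_conj be))); split.
  apply/imag_unit_iff; split.
    by rewrite odot_scal_l odot_mult_conj_one vb Rmult_0_r.
  rewrite odot_scal_l odot_sym odot_scal_l odot_mult_mult odot_conj vv bb. by field.
rewrite oct_mult_scal_l oct_mult_conj_mult bb [RHS]wE. f_equal.
apply: odot_ext => c. rewrite !(odot_sym c) !odot_scal_l. by field.
Qed.
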